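(* Let $G$ and $N$ be networks that intersect in exactly one vertex $v$. Let $w'\ne v$ be a vertex of $G$ and $w''\ne v$ a vertex of $N$. Let $U=G\cup N$, let $W$ be the network obtained from $U$ by identifying $w'$ and $w''$, and let $w$ be the image of $w'$ and $w''$ in $W$. Suppose $\{v,w'\}$ is amicable in $G$ and $\{v,w''\}$ is amicable in $N$. Then: (a) $\{v,w'\}$ and $\{v,w''\}$ are amicable in $U$; (b) $\{v,w\}$ is amicable in $W$; (c) $\{w',w''\}$ is very amicable in $U$.
   Context: A network is a finite connected loopless multigraph, possibly with multiple edges. Polynomials attached to a loopless multigraph. Let $G$ have $m$ edges and $n$ vertices, and put $d=m-n+1$. Let $R_G(q)$ be the probability that deleting each edge independently with probability $q$ leaves a connected spanning subgraph. Put $H_G(q)=(1-q)^{1-n}R_G(q)$ (a polynomial) and $J_G(u)=(u-1)^dH_G\big(\frac{-1-u}{1-u}\big)$. If $G$ is disconnected then $R_G\equiv0$, so $J_G\equiv0$. Write $J_G(u)=J^G_0(u^2)+uJ^G_1(u^2)$ with $J^G_0,J^G_1\in\mathbb{R}[x]$. Relation $\prec$: for $A,B\in\mathbb{R}[x]$ with only real zeros, with zeros $\xi_1\le\cdots\le\xi_a$ of $A$ and $\theta_1\le\cdots\le\theta_b$ of $B$, $A\prec B$ means one of the following: - $\deg B=\deg A+1$ and $\theta_1\le\xi_1\le\theta_2\le\cdots\le\xi_a\le\theta_{a+1}$; - $\deg A=\deg B$ and $\xi_1\le\theta_1\le\cdots\le\xi_a\le\theta_a$. By convention $A\prec0$ and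 $0\prec A$ for every $A$ with only real zeros. A polynomial is standard if it is identically $0$ or has positive leading coefficient. It has only nonpositive zeros if it is identically $0$ or all its zeros are real and $\le0$. An interpolatory 1-cube is a pair $(A,B)$ of standard polynomials with only nonpositive zeros such that $A\prec B$. A quadruple $(A,B,P,Q)$ of polynomials in $\mathbb{R}[x]$ is an interpolatory square if, for all $\lambda,\rho>0$, both $(\lambda A+\rho B,\lambda P+\rho Q)$ and $(\lambda B+\rho xA,\lambda Q+\rho xP)$ are interpolatory 1-cubes. Amicability. For a network $G$ and distinct vertices $v,w$: - $G^-$ is obtained from $G$ by deleting all edges between $v$ and $w$; - $G^\bullet$ is obtained by identifying $v$ and $w$ and removing the loops created; - $J^-_i:=J^{G^-}_i$ and $J^\bullet_i:=J^{G^\bullet}_i$. The pair $\{v,w\}$ is amicable in $G$ if $(J^-_1+J^\bullet_1,\ J^-_0+J^\bullet_0,\ J^-_0,\ xJ^-_1)$ is an interpolatory square. It is very amicable in $G$ if $(J^\bullet_1,\ J^\bullet_0,\ J^-_0,\ xJ^-_1)$ is an interpolatory square. *)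

(* Defs.v *)
From HB Require Import structures.
From mathcomp Require Import all_boot all_order all_algebra.
From mathcomp Require Import reals.
Set Implicit Arguments. Unset Strict Implicit. Unset Printing Implicit Defensive.
Import Order.TTheory GRing.Theory Num.Theory.
Local Open Scope ring_scope.

(* (a list, so parallel edges are allowed).                            *)
Record mgraph (T : finType) := MGraph { gV : {set T}; gE : seq (T * T) }.

Section Graphs.
Variable T : finType.
Implicit Types (G : mgraph T) (x y a b : T).

Definition loopless_mg G : Prop :=
  forall e, e \in gE G -> [/\ e.1 \in gV G, e.2 \in gV G & e.1 != e.2].

Definition sub_adj G (S : {set 'I_(size (gE G))}) : rel T :=
  fun x y => [exists i in S,
    let e := nth (x, x) (gE G) i in
    ((e.1 == x) && (e.2 == y)) || ((e.1 == y) && (e.2 == x))].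

Definition spanning_connected G (S : {set 'I_(size (gE G))}) : bool :=
  [forall x in gV G, forall y in gV G, connect (sub_adj S) x y].

Definition connected_mg G : bool := spanning_connected [set: 'I_(size (gE G))].

Definition network G : Prop :=
  [/\ loopless_mg G, gV G != set0 & connected_mg G].

Variable R : realType.

(* Reliability polynomial in the variable q = 'X: each edge is deleted
   independently with probability q; sum over sets S of kept edges. *)
Definition relpoly G : {poly R} :=
  \sum_(S : {set 'I_(size (gE G))} | spanning_connected S)
     (1 - 'X) ^+ #|S| * 'X ^+ (size (gE G) - #|S|).

Definition Hpoly G : {poly R} := relpoly G %/ (1 - 'X) ^+ (#|gV G| - 1).

(* d = m - n + 1 (only used when G is connected, so that d >= 0) *)
Definition cyc_dim G : nat := (size (gE G) + 1 - #|gV G|)%N.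

(* J_G(u) = (u-1)^d H_G((-1-u)/(1-u)); since deg H_G <= d this equals
   (-1)^d * sum_{k<=d} h_k (-1-u)^k (1-u)^(d-k).  If G is disconnected,
   H_G = 0 and hence J_G = 0. *)
Definition Jpoly G : {poly R} :=
  (-1) ^+ cyc_dim G *
  \sum_(k < (cyc_dim G).+1)
     (Hpoly G)`_k *: ((-1 - 'X) ^+ k * (1 - 'X) ^+ (cyc_dim G - k)).

Definition J0 G : {poly R} := even_poly (Jpoly G).
Definition J1 G : {poly R} := odd_poly (Jpoly G).

Definition del_edges G a b : mgraph T :=
  MGraph (gV G) [seq e <- gE G | ~~ ((e == (a, b)) || (e == (b, a)))].

Definition identify G a b : mgraph T :=
  let rn x := if x == b then a else x in
  MGraph (gV G :\ b)
    [seq e <- [seq (rn e.1, rn e.2) | e <- gE G] | e.1 != e.2].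

Definition union_mg G1 G2 : mgraph T :=
  MGraph (gV G1 :|: gV G2) (gE G1 ++ gE G2).

End Graphs.

Section Interlace.
Variable R : realType.
Implicit Types (A B P Q : {poly R}).

Definition sorted_roots A (rs : seq R) : Prop :=
  A = lead_coef A *: \prod_(r <- rs) ('X - r%:P) /\ sorted <=%R rs.

Definition real_rooted A : Prop := exists rs, sorted_roots A rs.

Definition prec A B : Prop :=
  real_rooted A /\ real_rooted B /\
  (A = 0 \/ B = 0 \/
   exists xs ts, sorted_roots A xs /\ sorted_roots B ts /\ A != 0 /\ B != 0 /\
     ( (size ts = (size xs).+1 /\
        forall i, (i < size xs)%N ->
          ts`_i <= xs`_i /\ xs`_i <= ts`_i.+1)
     \/
       (size ts = size xs /\
        forall i, (i < size xs)%N ->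
          xs`_i <= ts`_i /\ ((i.+1 < size xs)%N -> ts`_i <= xs`_i.+1)))).

Definition standard A : Prop := A = 0 \/ 0 < lead_coef A.

Definition nonpos_rooted A : Prop :=
  A = 0 \/ exists rs, sorted_roots A rs /\ all (fun r => r <= 0) rs.

Definition interp_cube A B : Prop :=
  [/\ standard A, standard B, nonpos_rooted A, nonpos_rooted B & prec A B].

Definition interp_square A B P Q : Prop :=
  forall lam rho : R, 0 < lam -> 0 < rho ->
    interp_cube (lam *: A + rho *: B) (lam *: P + rho *: Q) /\
    interp_cube (lam *: B + rho *: ('X * A)) (lam *: Q + rho *: ('X * P)).

End Interlace.

Section Amicable.
Variables (R : realType) (T : finType).

Definition amicable (G : mgraph T) (v w : T) : Prop :=
  let Gm := del_edges G v w in
  let Gb := identify G v w in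
  interp_square (J1 R Gm + J1 R Gb) (J0 R Gm + J0 R Gb) (J0 R Gm) ('X * J1 R Gm).

Definition very_amicable (G : mgraph T) (v w : T) : Prop :=
  let Gm := del_edges G v w in
  let Gb := identify G v w in
  interp_square (J1 R Gb) (J0 R Gb) (J0 R Gm) ('X * J1 R Gm).

End Amicable.

(* Main.v *)
(* Write a polynomial as f(u) = f_0(u^2) + u f_1(u^2) and put x = u^2.  A pair of
   polynomials with nonnegative coefficients is an interpolatory 1-cube (A, B)
   iff A and B do not vanish on the upper half plane H and B(x) / A(x) lies in
   the closed convex cone spanned by 1 and x for all x in H: one direction is an
   induction on interlacing zeros, the other follows the argument of B / A along
   the half circles |x| = r and counts zeros by the intermediate value theorem.

   Set delta = J^- and alpha = J^- + J^o, where J^o belongs to the graph with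
   the two vertices identified.  Amicability says that, for every x in H, the
   Moebius map n |-> (n delta_0 + x delta_1) / (n alpha_1 + alpha_0) sends the
   two boundary rays of the cone into the cone; since its pole -alpha_0/alpha_1
   lies in the opposite cone, it then sends the whole cone into itself.  For
   this reason the condition survives multiplication of alpha and delta by a
   Hurwitz polynomial (one-vertex unions), and with (alpha', delta') it passes
   to (alpha alpha' + delta delta', delta alpha' + alpha delta') (parallel
   connection, and with (u, 1) the addition of an edge) and to
   (delta alpha' + alpha delta', delta delta') (series connection).  These three
   operations are (a), (b) and (c).

   On the graph side, J is (-2)^(1-n) times the sum over connected spanning
   edge sets S of (-2)^|S| (1+u)^(m-|S|), and connectivity after identifying two
   vertices is connectivity after adding an edge between them. *)

Require Import Defs.
From HB Require Import structures.
From mathcomp Require Import all_boot all_order all_algebra.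
From mathcomp Require Import reals.
From mathcomp Require Import topology normedtype trigo.
From mathcomp Require Import complex.
From mathcomp Require Import zify ring lra.
Set Implicit Arguments. Unset Strict Implicit. Unset Printing Implicit Defensive.
Import Order.TTheory GRing.Theory Num.Theory.
Import numFieldNormedType.Exports.
Local Open Scope ring_scope.

Local Notation Re := complex.Re.
Local Notation Im := complex.Im.

(** * Cones in the upper half plane *)

Section Cone.
Variable R : rcfType.
Implicit Types (x a b c : R[i]) (r s : R).

(** The imaginary part of conj(a) b: its sign tells on which side of the line through 0 and [a] the
    point [b] lies, without dividing by [a]. *)
Definition cross a b : R := Re a * Im b - Im a * Re b.

(* [b / a] lies in the closed convex cone spanned by [1] and [x]. *)
Definition cone x a b : Prop := 0 <= cross a b /\ 0 <= cross b (x * a).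

Definition sqmod a : R := Re a ^+ 2 + Im a ^+ 2.

Lemma sqmod_ge0 a : 0 <= sqmod a.
Proof. by rewrite addr_ge0 ?sqr_ge0. Qed.

Lemma sqmod_eq0 a : (sqmod a == 0) = (a == 0).
Proof. by rewrite paddr_eq0 ?sqr_ge0 // !sqrf_eq0 eq_complex. Qed.

Lemma sqmodM a b : sqmod (a * b) = sqmod a * sqmod b.
Proof. by case: a b => [a1 a2] [b1 b2]; rewrite /sqmod /=; ring. Qed.

Lemma sqmod_real (c : R) : sqmod c%:C%C = c ^+ 2.
Proof. by rewrite /sqmod /= expr0n addr0. Qed.

Lemma Im_neq0 x : 0 < Im x -> x != 0.
Proof. by apply: contraTneq => ->; rewrite ltxx. Qed.

Lemma crossDl a b c : cross (a + b) c = cross a c + cross b c.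
Proof. by case: a b c => [a1 a2] [b1 b2] [c1 c2]; rewrite /cross /=; ring. Qed.

Lemma crossDr a b c : cross a (b + c) = cross a b + cross a c.
Proof. by case: a b c => [a1 a2] [b1 b2] [c1 c2]; rewrite /cross /=; ring. Qed.

Lemma crossM c a b : cross (c * a) (c * b) = sqmod c * cross a b.
Proof.
by case: a b c => [a1 a2] [b1 b2] [c1 c2]; rewrite /cross /sqmod /=; ring.
Qed.

Lemma cone_scale c x a b : cone x a b -> cone x (c * a) (c * b).
Proof.
by case=> h1 h2; split; rewrite ?[x * _]mulrCA crossM mulr_ge0 ?sqmod_ge0.
Qed.

Lemma coneDr x a b b' : cone x a b -> cone x a b' -> cone x a (b + b').
Proof. by case=> ? ? [? ?]; split; rewrite ?crossDr ?crossDl addr_ge0. Qed.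

Lemma coneDl x a a' b : cone x a b -> cone x a' b -> cone x (a + a') b.
Proof.
by case=> ? ? [? ?]; split; rewrite ?mulrDr ?crossDr ?crossDl addr_ge0.
Qed.

Lemma coneZ x a b (l m : R) : 0 <= l -> 0 <= m ->
  cone x a b -> cone x (l%:C%C * a) (m%:C%C * b).
Proof.
move=> l0 m0 [h1 h2]; split.
  have -> : cross (l%:C%C * a) (m%:C%C * b) = l * m * cross a b.
    by case: (a) (b) => [? ?] [? ?]; rewrite /cross /=; ring.
  by rewrite !mulr_ge0.
have -> : cross (m%:C%C * b) (x * (l%:C%C * a)) = l * m * cross b (x * a).
  by case: (x) (a) (b) => [? ?] [? ?] [? ?]; rewrite /cross /=; ring.
by rewrite !mulr_ge0.
Qed.

(** The division-free form of [cone] admits a zero on either side, in line with the convention for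
    [prec] and the zero polynomial. *)
Lemma cone0l x b : cone x 0 b.
Proof. by rewrite /cone mulr0 /cross /= !(mul0r, mulr0) subrr. Qed.

Lemma cone0r x a : cone x a 0.
Proof. by rewrite /cone /cross /= !(mul0r, mulr0) subrr. Qed.

(** The map n to x / n preserves the cone and exchanges its boundary rays. *)
Lemma cone_rot x a b : cone x a b -> cone x b (x * a).
Proof. by case=> ? ?; split=> //; rewrite crossM mulr_ge0 ?sqmod_ge0. Qed.

Lemma cone_unrot x a b : x != 0 -> cone x b (x * a) -> cone x a b.
Proof.
move=> x0 [h1]; rewrite crossM pmulr_rge0 //.
by rewrite lt_neqAle eq_sym sqmod_eq0 x0 sqmod_ge0.
Qed.

(** With u^2 = x, the pairs are the parities of e + u o and e' + u o', and the conclusion concerns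
    their product. Both cross products expand into terms that are nonnegative by hypothesis. *)
Lemma coneM x o e o' e' :
  cone x o e -> cone x o' e' -> cone x (e * o' + o * e') (e * e' + x * o * o').
Proof.
move=> [h1 h2] [h3 h4]; split.
  have -> : cross (e * o' + o * e') (e * e' + x * o * o') =
    sqmod e * cross o' e' + sqmod e' * cross o e +
    sqmod o' * cross e (x * o) + sqmod o * cross e' (x * o').
    case: x o e o' e' {h1 h2 h3 h4} => [x1 x2] [o1 o2] [e1 e2] [a1 a2] [b1 b2].
    by rewrite /cross /sqmod /=; ring.
  by rewrite !addr_ge0 // mulr_ge0 ?sqmod_ge0.
have -> : cross (e * e' + x * o * o') (x * (e * o' + o * e')) =
    sqmod e * cross e' (x * o') + sqmod e' * cross e (x * o) +
    sqmod x * sqmod o' * cross o e + sqmod x * sqmod o * cross o' e'.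
  case: x o e o' e' {h1 h2 h3 h4} => [x1 x2] [o1 o2] [e1 e2] [a1 a2] [b1 b2].
  by rewrite /cross /sqmod /=; ring.
by rewrite !addr_ge0 // !mulr_ge0 ?sqmod_ge0.
Qed.

Lemma cone_decomp x a b : 0 < Im x -> a != 0 -> cone x a b ->
  exists m n : R, [/\ 0 <= m, 0 <= n & b = (m%:C%C + n%:C%C * x) * a].
Proof.
move=> x0 a0 [h1 h2].
have N0 : 0 < sqmod a by rewrite lt_neqAle eq_sym sqmod_eq0 a0 sqmod_ge0.
have N1 : sqmod a != 0 by rewrite gt_eqF.
have x1 : Im x != 0 by rewrite gt_eqF.
(* Cramer's rule for the real coordinates of b / a in the basis 1, x. *)
exists (cross b (x * a) / (Im x * sqmod a)), (cross a b / (Im x * sqmod a)).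
split; try by rewrite divr_ge0 ?mulr_ge0 ?sqmod_ge0 // ltW.
case: x a b x0 a0 h1 h2 N0 N1 x1 => [x1 x2] [a1 a2] [b1 b2] /=.
rewrite /cross /sqmod /= => x0 a0 h1 h2 N0 N1 x3.
by apply/eqP; rewrite eq_complex /=; apply/andP; split; apply/eqP; field;
  rewrite x3 N1.
Qed.

(* The cone is pointed because [0 < Im x]. *)
Lemma cone_add_eq0 x a b b' : 0 < Im x -> a != 0 ->
  cone x a b -> cone x a b' -> b + b' = 0 -> b = 0 /\ b' = 0.
Proof.
move=> x0 a0 h h' E.
have [m [n [m0 n0 Eb]]] := cone_decomp x0 a0 h.
have [m' [n' [m0' n0' Eb']]] := cone_decomp x0 a0 h'.
have : (m + m')%:C%C + (n + n')%:C%C * x == 0.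
  move/eqP: E; rewrite Eb Eb' -mulrDl mulf_eq0 (negPf a0) orbF => /eqP E.
  by rewrite !rmorphD /= -E; apply/eqP; ring.
have -> : ((m + m')%:C%C + (n + n')%:C%C * x == 0) =
    (m + m' + (n + n') * Re x == 0) && ((n + n') * Im x == 0).
  by case: (x) => x1 x2; rewrite eq_complex /= !mul0r !subr0 !add0r !addr0.
rewrite mulf_eq0 (gt_eqF x0) orbF => /andP[E1 /eqP E2].
move: E1 (E2); rewrite E2 mul0r addr0 => /eqP E1 _.
move: (introT eqP E1) (introT eqP E2); rewrite !paddr_eq0 //.
move=> /andP[/eqP mz /eqP mz'] /andP[/eqP nz /eqP nz'].
by rewrite Eb Eb' mz mz' nz nz' !mul0r addr0 !mul0r.
Qed.

End Cone.

(** * Real quadratic functions on a quadrant *)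

Section Quadratic.
Variable R : realFieldType.
Implicit Types (a b c k m n r s : R).

Lemma quad_limit_ge0 a k b :
  (forall r, 0 < r -> 0 <= a + r * k + r ^+ 2 * b) -> 0 <= a.
Proof.
move=> H; rewrite leNgt; apply/negP => a0.
pose d := `|k| + `|b| + 1.
have d1 : 1 <= d by rewrite lerDr addr_ge0.
have d0 : 0 < d by apply: lt_le_trans d1.
(* If a < 0, this [r] keeps the two correction terms together at most - a / 2. *)
pose r := Num.min 1 (- a / (2 * d)).
have r0 : 0 < r by rewrite lt_min ltr01 divr_gt0 ?oppr_gt0 // mulr_gt0.
have rle1 : r <= 1 by rewrite ge_min lexx.
have rle2 : r * d <= - a / 2.
  rewrite -ler_pdivlMr //; apply: (le_trans (_ : r <= - a / (2 * d))).
    by rewrite ge_min lexx orbT.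
  by rewrite invfM mulrA.
have := H r r0; apply/negP; rewrite -ltNge.
have h1 : r * k <= r * `|k| by rewrite ler_pM2l // ler_norm.
have h2 : r ^+ 2 * b <= r * `|b|.
  apply: (le_trans (_ : _ <= r ^+ 2 * `|b|)).
    by rewrite ler_pM2l ?exprn_gt0 // ler_norm.
  by rewrite ler_wpM2r // expr2 ger_pMl.
have : r * `|k| + r * `|b| <= - a / 2.
  by apply: le_trans rle2; rewrite /d !mulrDr mulr1 lerDl ltW.
lra.
Qed.

(** The limit r to infinity, obtained from [quad_limit_ge0] at 1 / r. *)
Lemma affine_limit_ge0 k c : (forall r, 0 < r -> 0 <= r * k + c) -> 0 <= k.
Proof.
move=> H; apply: (@quad_limit_ge0 k c 0) => r r0; rewrite mulr0 addr0.
have ri : 0 < r^-1 by rewrite invr_gt0.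
have := H _ ri; rewrite -(pmulr_rge0 _ r0) mulrDr mulrA divff ?gt_eqF //.
by rewrite mul1r.
Qed.

(* Restricted to a line through [(- mu, - nu)] the function is
   [s |-> c0 * s + c1 * s ^+ 2] with [0 <= c1], so nonnegativity at a point of
   the ray propagates away from [(- mu, - nu)]; the ray from [(m, n)] towards
   [(- mu, - nu)] leaves the quadrant through one of its sides. *)
Lemma quad_quadrant_ge0 a11 a12 a22 k1 k2 c mu nu :
  let g m n :=
    a11 * m ^+ 2 + a12 * m * n + a22 * n ^+ 2 + k1 * m + k2 * n + c in
  (forall m, 0 < m -> 0 <= g m 0) -> (forall n, 0 < n -> 0 <= g 0 n) ->
  (forall m n, 0 <= m -> 0 <= n ->
     0 <= a11 * m ^+ 2 + a12 * m * n + a22 * n ^+ 2) ->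
  0 <= mu -> 0 <= nu -> g (- mu) (- nu) = 0 ->
  forall m n, 0 <= m -> 0 <= n -> 0 <= g m n.
Proof.
move=> g gm gn q0 mu0 nu0 gp m n.
have c0 : 0 <= c.
  apply: (@quad_limit_ge0 c k1 a11) => r /gm.
  by rewrite /g; congr (0 <= _); ring.
have gm' r : 0 <= r -> 0 <= g r 0.
  rewrite le_eqVlt => /predU1P[<-|/gm//].
  by rewrite /g !(expr0n, mulr0, addr0, add0r).
have gn' r : 0 <= r -> 0 <= g 0 r.
  rewrite le_eqVlt => /predU1P[<-|/gn//].
  by rewrite /g !(expr0n, mulr0, addr0, add0r).
rewrite le_eqVlt => /predU1P[<- /gn'//|m0].
rewrite le_eqVlt => /predU1P[<-|n0]; first exact/gm'/ltW.
have key s : 0 < s -> s <= 1 ->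
    0 <= g (s * m - (1 - s) * mu) (s * n - (1 - s) * nu) -> 0 <= g m n.
  move=> s0 s1 H.
  pose c1 := a11 * (m + mu) ^+ 2 + a12 * (m + mu) * (n + nu)
    + a22 * (n + nu) ^+ 2.
  have E : s * g m n = g (s * m - (1 - s) * mu) (s * n - (1 - s) * nu)
      + s * (1 - s) * c1 - (1 - s) * g (- mu) (- nu).
    by rewrite /g /c1; ring.
  rewrite -(pmulr_rge0 _ s0) E gp mulr0 subr0; apply: addr_ge0 => //.
  apply: mulr_ge0; first by rewrite mulr_ge0 ?subr_ge0 // ltW.
  by apply: q0; apply: addr_ge0 => //; exact: ltW.
(* For mu = nu = 0 the ray ends at the origin, where [g] vanishes; both linear coefficients are then
   nonnegative because [g] is nonnegative on the axes near the origin. *)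
have corner : mu = 0 -> nu = 0 -> 0 <= g m n.
  move=> mz nz; move: gp; rewrite /g mz nz oppr0 !(expr0n, mulr0, addr0, add0r).
  move=> cz; rewrite cz addr0.
  have k1_ge0 : 0 <= k1.
    apply: (@quad_limit_ge0 k1 a11 0) => r r0; rewrite -(pmulr_rge0 _ r0).
    by have := gm r r0; rewrite /g cz; congr (0 <= _); ring.
  have k2_ge0 : 0 <= k2.
    apply: (@quad_limit_ge0 k2 a22 0) => r r0; rewrite -(pmulr_rge0 _ r0).
    by have := gn r r0; rewrite /g cz; congr (0 <= _); ring.
  have := q0 m n (ltW m0) (ltW n0) => H.
  by rewrite addr_ge0 ?mulr_ge0 ?(ltW n0) // addr_ge0 ?mulr_ge0 ?(ltW m0).
(* The sign of mu n - nu m decides which axis the segment from (m, n) to (- mu, - nu) meets first;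
   the parameter given to [key] is the point where it does. *)
have [le|/ltW le] := leP (nu * m) (mu * n).
  move: mu0; rewrite le_eqVlt => /predU1P[mz|mu0].
    apply: corner => //; apply/eqP; rewrite eq_le nu0 andbT.
    by move: le; rewrite -mz mul0r pmulr_lle0.
  have d0 : 0 < m + mu by rewrite addr_gt0.
  apply: (key (mu / (m + mu))).
  - by rewrite divr_gt0.
  - by rewrite ler_pdivrMr // mul1r lerDr ltW.
  have -> : mu / (m + mu) * m - (1 - mu / (m + mu)) * mu = 0.
    by field; rewrite gt_eqF.
  have -> : mu / (m + mu) * n - (1 - mu / (m + mu)) * nu =
      (mu * n - nu * m) / (m + mu) by field; rewrite gt_eqF.
  by apply: gn'; rewrite divr_ge0 ?subr_ge0 // ltW.
move: nu0; rewrite le_eqVlt => /predU1P[nz|nu0].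
  apply: corner => //; apply/eqP; rewrite eq_le mu0 andbT.
  by move: le; rewrite -nz mul0r pmulr_lle0.
have d0 : 0 < n + nu by rewrite addr_gt0.
apply: (key (nu / (n + nu))).
- by rewrite divr_gt0.
- by rewrite ler_pdivrMr // mul1r lerDr ltW.
have -> : nu / (n + nu) * n - (1 - nu / (n + nu)) * nu = 0.
  by field; rewrite gt_eqF.
have -> : nu / (n + nu) * m - (1 - nu / (n + nu)) * mu =
    (nu * m - mu * n) / (n + nu) by field; rewrite gt_eqF.
by apply: gm'; rewrite divr_ge0 ?subr_ge0 // ltW.
Qed.

End Quadratic.

(** * The Moebius condition: from the boundary rays to the whole cone *)

Section ConeSquare.
Variable R : rcfType.
Local Open Scope complex_scope.
Implicit Types (x a b p q : R[i]).

(* [cross (n a + b) (n p + q)] for [n = m + n' x]: the pole [- b / a] of the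
   Moebius map lies in the opposite cone, as [quad_quadrant_ge0] requires. *)
Lemma cross_quadrant_ge0 x a b p q : 0 < Im x -> cone x a b ->
  0 <= cross a p ->
  (forall m : R, 0 < m -> 0 <= cross (m%:C * a + b) (m%:C * p + q)) ->
  (forall n : R, 0 < n ->
     0 <= cross (n%:C * x * a + b) (n%:C * x * p + q)) ->
  forall m n : R, 0 <= m -> 0 <= n ->
    0 <= cross ((m%:C + n%:C * x) * a + b) ((m%:C + n%:C * x) * p + q).
Proof.
move=> x0 ab ap hm hn m n m0 n0.
pose al := cross a p.
pose k1 := cross a q + cross b p.
pose k2 := cross (x * a) q + cross b (x * p).
pose be := cross b q.
pose g m n := al * m ^+ 2 + (2 * Re x * al) * m * n + (sqmod x * al) * n ^+ 2
  + k1 * m + k2 * n + be.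
have gE (i j : R) :
    cross ((i%:C + j%:C * x) * a + b) ((i%:C + j%:C * x) * p + q) = g i j.
  rewrite /g /al /k1 /k2 /be /cross /sqmod.
  case: (x) (a) (b) (p) (q) => [x1 x2] [a1 a2] [b1 b2] [p1 p2] [q1 q2] /=.
  by ring.
rewrite gE.
have gm i : 0 < i -> 0 <= g i 0.
  by move=> /hm; rewrite -gE mul0r addr0.
have gn i : 0 < i -> 0 <= g 0 i.
  by move=> /hn; rewrite -gE add0r.
have q0 i j : 0 <= al * i ^+ 2 + (2 * Re x * al) * i * j + (sqmod x * al) * j ^+ 2.
  have -> : al * i ^+ 2 + (2 * Re x * al) * i * j + (sqmod x * al) * j ^+ 2 =
    al * ((i + Re x * j) ^+ 2 + (Im x * j) ^+ 2) by rewrite /sqmod; ring.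
  by rewrite mulr_ge0 // addr_ge0 ?sqr_ge0.
(* For a = 0 there is no finite pole. Then [g] is affine, and its three coefficients are limits of
   nonnegative values along the axes. *)
have [az|a0] := eqVneq a 0.
  have alz : al = 0 by rewrite /al az /cross /= !mul0r subrr.
  have be0 : 0 <= be.
    apply: (@quad_limit_ge0 _ be k1 al) => r /gm; rewrite /g.
    by congr (0 <= _); ring.
  have k1_ge0 : 0 <= k1.
    apply: (@affine_limit_ge0 _ k1 be) => r /gm; rewrite /g alz.
    by congr (0 <= _); ring.
  have k2_ge0 : 0 <= k2.
    apply: (@affine_limit_ge0 _ k2 be) => r /gn; rewrite /g alz.
    by congr (0 <= _); ring.
  by rewrite /g alz !(mulr0, mul0r, add0r) addr_ge0 // addr_ge0 // mulr_ge0.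
have [mu [nu [mu0 nu0 Eb]]] := cone_decomp x0 a0 ab.
apply: (@quad_quadrant_ge0 _ al (2 * Re x * al) (sqmod x * al) k1 k2 be mu nu)
  => //.
rewrite -/(g (- mu) (- nu)) -gE Eb.
have -> : ((- mu)%:C + (- nu)%:C * x) * a + (mu%:C + nu%:C * x) * a = 0.
  by rewrite !rmorphN /=; ring.
by rewrite /cross /= !mul0r subrr.
Qed.

(** Real combinations control only the boundary rays n = m and n = m x; [cross_quadrant_ge0] fills
    in the interior for each of the two inequalities that define the cone. The point n1 = 0 is the
    limit r to 0. *)
Lemma cone_square x a b p q : 0 < Im x -> cone x a b ->
  (forall l r : R, 0 < l -> 0 < r ->
     cone x (l%:C * a + r%:C * b) (l%:C * p + r%:C * q)) ->
  (forall l r : R, 0 < l -> 0 < r ->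
     cone x (l%:C * b + r%:C * (x * a)) (l%:C * q + r%:C * (x * p))) ->
  forall n0 n1 : R[i], cone x n1 n0 -> cone x (n0 * a + n1 * b) (n0 * p + n1 * q).
Proof.
move=> x0 ab h1 h2 n0 n1 n10.
have h1' m : 0 < m -> cone x (m%:C * a + b) (m%:C * p + q).
  by move=> m0; have := h1 m 1 m0 ltr01; rewrite !rmorph1 !mul1r.
have h2' m : 0 < m -> cone x (m%:C * x * a + b) (m%:C * x * p + q).
  move=> m0; have := h2 1 m ltr01 m0; rewrite !rmorph1 !mul1r.
  by rewrite ![_ + m%:C * _]addrC !mulrA.
have xa : cone x a p.
  split.
    apply: (@quad_limit_ge0 _ _ (cross a q + cross b p) (cross b q)) => r r0.
    have [+ _] := h1 1 r ltr01 r0; congr (0 <= _); rewrite /cross.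
    by case: (a) (b) (p) (q) => [a1 a2] [b1 b2] [p1 p2] [q1 q2] /=; ring.
  apply: (@quad_limit_ge0 _ _ (cross p (x * b) + cross q (x * a))
    (cross q (x * b))) => r r0.
  have [_ +] := h1 1 r ltr01 r0; congr (0 <= _); rewrite /cross.
  case: (x) (a) (b) (p) (q) => [x1 x2] [a1 a2] [b1 b2] [p1 p2] [q1 q2] /=.
  by ring.
have [->|n1z] := eqVneq n1 0.
  by rewrite !mul0r !addr0; exact: cone_scale.
have [m [n [m0 n0' ->]]] := cone_decomp x0 n1z n10.
have -> : (m%:C + n%:C * x) * n1 * a + n1 * b = n1 * ((m%:C + n%:C * x) * a + b).
  by ring.
have -> : (m%:C + n%:C * x) * n1 * p + n1 * q = n1 * ((m%:C + n%:C * x) * p + q).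
  by ring.
apply: cone_scale; split.
  apply: cross_quadrant_ge0 => //; first by case: xa.
    by move=> i /h1'[].
  by move=> i /h2'[].
(* Antisymmetry of [cross] turns the second inequality into the first one with - x a and - x b in
   place of [a] and [b]. *)
have N u v : cross u v = cross (- v) u by rewrite /cross /=; case: u v => ? ? [? ?] /=; ring.
have -> : cross ((m%:C + n%:C * x) * p + q) (x * ((m%:C + n%:C * x) * a + b)) =
  cross ((m%:C + n%:C * x) * (- (x * a)) + (- (x * b))) ((m%:C + n%:C * x) * p + q).
  by rewrite N; congr (cross _ _); ring.
have E z : cross (z * (- (x * a)) + (- (x * b))) (z * p + q) =
  cross (z * p + q) (x * (z * a + b)).
  by rewrite [RHS]N; congr (cross _ _); ring.
apply: cross_quadrant_ge0 => //.
- have := cone_scale (- x) ab; congr cone; ring.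
- by case: xa => _; rewrite N.
- by move=> i /h1'[_]; rewrite E.
- by move=> i /h2'[_]; rewrite E.
Qed.

End ConeSquare.

(** * The square condition at one point and its compositions *)

Section PointSquare.
Variable R : rcfType.
Implicit Types (x a b e o : R[i]).

Lemma cone_addl_eq0 x a b b' : 0 < Im x -> a != 0 ->
  cone x b a -> cone x b' a -> b + b' = 0 -> b = 0 /\ b' = 0.
Proof.
move=> x0 a0 /cone_rot h /cone_rot h' /(congr1 (fun z => x * z)).
have xz := Im_neq0 x0.
rewrite mulrDr mulr0 => /(cone_add_eq0 x0 a0 h h')[/eqP + /eqP].
by rewrite !mulf_eq0 (negPf xz) => /eqP-> /eqP->.
Qed.

Lemma cone11 x : 0 < Im x -> cone x 1 1.
Proof.
move=> x0; rewrite /cone mulr1 /cross /= mulr0 !mul0r mul1r subrr lexx.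
by rewrite subr0 ltW.
Qed.

(* With [f = e + u o] and [u^2 = x], [(e, o)] and [(e', o')] multiply to the
   two sums below. *)
Lemma cone_prod_eq0 x o e o' e' : 0 < Im x -> cone x o e -> cone x o' e' ->
  e * e' + x * (o * o') = 0 -> e * o' + o * e' = 0 ->
  (e = 0 /\ o = 0) \/ (e' = 0 /\ o' = 0).
Proof.
move=> x0 h h' E1 E2.
have xz := Im_neq0 x0.
have : e * e' = 0 /\ x * (o * o') = 0.
  have [z|nz] := eqVneq (e * o') 0.
    move/eqP: z; rewrite mulf_eq0 => /orP[/eqP z|/eqP z];
      by move: E1; rewrite z !(mul0r, mulr0) ?add0r ?addr0.
  apply: (cone_add_eq0 x0 nz) => //; first exact: cone_scale.
  by have /(cone_scale o') := cone_rot h; rewrite [o' * e]mulrC mulrCA [o' * o]mulrC.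
have : e * o' = 0 /\ o * e' = 0.
  have [z|nz] := eqVneq (e * e') 0.
    move/eqP: z; rewrite mulf_eq0 => /orP[/eqP z|/eqP z];
      by move: E2; rewrite z !(mul0r, mulr0) ?add0r ?addr0.
  apply: (cone_addl_eq0 x0 nz) => //; first exact: cone_scale.
  by have := cone_scale e' h; rewrite ![e' * _]mulrC.
move=> [/eqP + /eqP +] [/eqP + /eqP]; rewrite !mulf_eq0 (negPf xz) /=.
have [->|_] := eqVneq e 0; have [->|_] := eqVneq o 0;
  have [->|_] := eqVneq e' 0; have [->|_] := eqVneq o' 0 => //=; by auto.
Qed.

(** In the first combination both terms lie in the cone over [o], in the second both lie in the cone
    over [e]. The cone is pointed, so such terms cancel only if both vanish. *)
Lemma cone_comb_neq0 x o e (l r : R) : 0 < Im x -> 0 < l -> 0 < r ->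
  cone x o e -> ~ (e = 0 /\ o = 0) ->
  l%:C%C * o + r%:C%C * e != 0 /\ l%:C%C * e + r%:C%C * (x * o) != 0.
Proof.
move=> x0 l0 r0 h nz.
have xz := Im_neq0 x0.
have lz : l%:C%C != 0 by rewrite eq_complex /= gt_eqF.
have rz : r%:C%C != 0 by rewrite eq_complex /= gt_eqF.
have sc (t : R) b c : 0 <= t -> cone x b c -> cone x b (t%:C%C * c).
  by move=> t0 /(coneZ ler01 t0); rewrite rmorph1 mul1r.
have self a : cone x a a by have := cone_scale a (cone11 x0); rewrite mulr1.
split; apply/eqP => E; apply: nz.
  have [o0|o0] := eqVneq o 0.
    by move/eqP: E; rewrite o0 mulr0 add0r mulf_eq0 (negPf rz) => /eqP.
  have [/eqP + /eqP] := cone_add_eq0 x0 o0 (sc l _ _ (ltW l0) (self o))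
    (sc r _ _ (ltW r0) h) E.
  by rewrite !mulf_eq0 (negPf lz) (negPf rz) => /eqP-> /eqP->.
have [e0|e0] := eqVneq e 0.
  move/eqP: E; rewrite e0 mulr0 add0r !mulf_eq0 (negPf rz) (negPf xz).
  by move=> /eqP.
have [/eqP + /eqP] := cone_add_eq0 x0 e0 (sc l _ _ (ltW l0) (self e))
  (sc r _ _ (ltW r0) (cone_rot h)) E.
by rewrite !mulf_eq0 (negPf lz) (negPf rz) (negPf xz) => /eqP-> /eqP->.
Qed.

(** Here n = n0 / n1 is given in homogeneous coordinates, and the indices 0 and 1 mark the even and
    odd parts of alpha and delta. *)
Definition point_square x a0 a1 d0 d1 : Prop :=
  [/\ cone x a1 a0, cone x d1 d0 & forall n0 n1 : R[i], cone x n1 n0 ->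
    cone x (n0 * a1 + n1 * a0) (n0 * d0 + n1 * (x * d1))].

(** The substitution of x / n for n exchanges the roles of alpha and delta. *)
Lemma point_square_swap x (a0 a1 d0 d1 n0 n1 : R[i]) : x != 0 ->
  point_square x a0 a1 d0 d1 -> cone x n1 n0 ->
  cone x (n0 * d1 + n1 * d0) (n0 * a0 + n1 * (x * a1)).
Proof.
move=> xz [_ _ H] /cone_rot /H h; apply: cone_unrot => //.
by move: h; congr cone; ring.
Qed.

(** The factor e + u o is absorbed into n, which stays in the cone by [coneM]. *)
Lemma point_square_mul x (a0 a1 d0 d1 e o : R[i]) : cone x o e ->
  point_square x a0 a1 d0 d1 ->
  point_square x (e * a0 + x * (o * a1)) (e * a1 + o * a0)
                 (e * d0 + x * (o * d1)) (e * d1 + o * d0).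
Proof.
move=> h [ha hd H]; split; rewrite ?mulrA; [exact: coneM|exact: coneM|].
move=> n0 n1 hn; have := H _ _ (coneM hn h).
by congr cone; ring.
Qed.

Section Compositions.
Variables (x a0 a1 d0 d1 a0' a1' d0' d1' : R[i]).
Hypothesis xz : x != 0.
Hypothesis h : point_square x a0 a1 d0 d1.
Hypothesis h' : point_square x a0' a1' d0' d1'.

(** Each of alpha alpha' and delta delta' shares one factor with each of delta alpha' and alpha
    delta'. That factor is absorbed into n, and what remains is one of the two given squares,
    swapped when delta or delta' is the shared factor. *)
Lemma point_square_cross (n0 n1 : R[i]) : cone x n1 n0 ->
  [/\ cone x (n0 * (a0 * a1' + a1 * a0') + n1 * (a0 * a0' + x * (a1 * a1')))
             (n0 * (d0 * a0' + x * (d1 * a1')) + n1 * (x * (d0 * a1' + d1 * a0'))),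
      cone x (n0 * (a0 * a1' + a1 * a0') + n1 * (a0 * a0' + x * (a1 * a1')))
             (n0 * (a0 * d0' + x * (a1 * d1')) + n1 * (x * (a0 * d1' + a1 * d0'))),
      cone x (n0 * (d0 * d1' + d1 * d0') + n1 * (d0 * d0' + x * (d1 * d1')))
             (n0 * (d0 * a0' + x * (d1 * a1')) + n1 * (x * (d0 * a1' + d1 * a0')))
    & cone x (n0 * (d0 * d1' + d1 * d0') + n1 * (d0 * d0' + x * (d1 * d1')))
             (n0 * (a0 * d0' + x * (a1 * d1')) + n1 * (x * (a0 * d1' + a1 * d0')))].
Proof.
move=> hn; have [ha hd H] := h; have [ha' hd' H'] := h'; split.
- by have := H _ _ (coneM hn ha'); congr cone; ring.
- by have := H' _ _ (coneM hn ha); congr cone; ring.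
- by have := point_square_swap xz h' (coneM hn hd); congr cone; ring.
- by have := point_square_swap xz h (coneM hn hd'); congr cone; ring.
Qed.

Lemma point_square_par (n0 n1 : R[i]) : cone x n1 n0 ->
  cone x (n0 * (a0 * a1' + a1 * a0' + (d0 * d1' + d1 * d0')) +
          n1 * (a0 * a0' + x * (a1 * a1') + (d0 * d0' + x * (d1 * d1'))))
         (n0 * (d0 * a0' + x * (d1 * a1') + (a0 * d0' + x * (a1 * d1'))) +
          n1 * (x * (d0 * a1' + d1 * a0' + (a0 * d1' + a1 * d0')))).
Proof.
move=> /point_square_cross[p1 p2 p3 p4].
by have := coneDr (coneDl p1 p3) (coneDl p2 p4); congr cone; ring.
Qed.

Lemma point_square_ser_cross (n0 n1 : R[i]) : cone x n1 n0 ->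
  cone x (n0 * (d0 * a1' + d1 * a0') + n1 * (d0 * a0' + x * (d1 * a1')))
         (n0 * (d0 * d0' + x * (d1 * d1')) + n1 * (x * (d0 * d1' + d1 * d0')))
  /\ cone x (n0 * (a0 * d1' + a1 * d0') + n1 * (a0 * d0' + x * (a1 * d1')))
         (n0 * (d0 * d0' + x * (d1 * d1')) + n1 * (x * (d0 * d1' + d1 * d0'))).
Proof.
move=> hn; have [ha hd H] := h; have [ha' hd' H'] := h'; split.
- by have := H' _ _ (coneM hn hd); congr cone; ring.
- by have := H _ _ (coneM hn hd'); congr cone; ring.
Qed.

Lemma point_square_ser (n0 n1 : R[i]) : cone x n1 n0 ->
  cone x (n0 * (d0 * a1' + d1 * a0' + (a0 * d1' + a1 * d0')) +
          n1 * (d0 * a0' + x * (d1 * a1') + (a0 * d0' + x * (a1 * d1'))))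
         (n0 * (d0 * d0' + x * (d1 * d1')) + n1 * (x * (d0 * d1' + d1 * d0'))).
Proof.
by move=> /point_square_ser_cross[p1 p2]; have := coneDl p1 p2; congr cone; ring.
Qed.

End Compositions.
End PointSquare.

(** * Even and odd parts of products *)

Section EvenOdd.
Variable F : comNzRingType.
Implicit Types (f g : {poly F}).

Lemma even_poly_comp f : even_poly (f \Po 'X^2) = f.
Proof.
apply/polyP => i; rewrite coef_even_poly coef_comp_poly_Xn //.
by rewrite -muln2 dvdn_mull // mulnK.
Qed.

Lemma odd_poly_comp f : odd_poly (f \Po 'X^2) = 0.
Proof.
apply/polyP => i; rewrite coef_odd_poly coef_comp_poly_Xn // coef0.
by rewrite dvdn2 /= odd_double.
Qed.

Lemma even_odd_comp f g :
  even_poly (f \Po 'X^2 + (g \Po 'X^2) * 'X) = f /\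
  odd_poly (f \Po 'X^2 + (g \Po 'X^2) * 'X) = g.
Proof.
rewrite even_polyD odd_polyD even_polyMX odd_polyMX !even_poly_comp.
by rewrite !odd_poly_comp mul0r addr0 add0r.
Qed.

Lemma poly_mul_even_odd f g : f * g =
  (even_poly f * even_poly g + 'X * (odd_poly f * odd_poly g)) \Po 'X^2 +
  ((even_poly f * odd_poly g + odd_poly f * even_poly g) \Po 'X^2) * 'X.
Proof.
rewrite -[in LHS](poly_even_odd f) -[in LHS](poly_even_odd g).
by rewrite !rmorphD !rmorphM /= comp_polyX; ring.
Qed.

Lemma even_polyM f g : even_poly (f * g) =
  even_poly f * even_poly g + 'X * (odd_poly f * odd_poly g).
Proof. by rewrite [in LHS]poly_mul_even_odd (even_odd_comp _ _).1. Qed.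

Lemma odd_polyM f g : odd_poly (f * g) =
  even_poly f * odd_poly g + odd_poly f * even_poly g.
Proof. by rewrite [in LHS]poly_mul_even_odd (even_odd_comp _ _).2. Qed.

End EvenOdd.

(** * Evaluation at complex points, nonnegative coefficients *)

Section PolyEval.
Variable R : rcfType.
Local Open Scope complex_scope.
Implicit Types (A B : {poly R}) (x : R[i]).

Definition ev A x : R[i] := (map_poly (real_complex R) A).[x].

Lemma ev0 x : ev 0 x = 0. Proof. by rewrite /ev rmorph0 horner0. Qed.
Lemma evD A B x : ev (A + B) x = ev A x + ev B x.
Proof. by rewrite /ev rmorphD hornerD. Qed.
Lemma evM A B x : ev (A * B) x = ev A x * ev B x.
Proof. by rewrite /ev rmorphM hornerM. Qed.
Lemma evX x : ev 'X x = x. Proof. by rewrite /ev map_polyX hornerX. Qed.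
Lemma evC (c : R) x : ev c%:P x = c%:C.
Proof. by rewrite /ev map_polyC hornerC. Qed.
Lemma evZ (c : R) A x : ev (c *: A) x = c%:C * ev A x.
Proof. by rewrite -mul_polyC evM evC. Qed.

Definition coef_ge0 A : Prop := forall i, 0 <= A`_i.

(** For a real polynomial this amounts to having only real zeros, since the others come in conjugate
    pairs. *)
Definition nonvanishing A : Prop := A = 0 \/ forall x, 0 < Im x -> ev A x != 0.

Lemma coef_ge0D A B : coef_ge0 A -> coef_ge0 B -> coef_ge0 (A + B).
Proof. by move=> hA hB i; rewrite coefD addr_ge0. Qed.

Lemma coef_ge0M A B : coef_ge0 A -> coef_ge0 B -> coef_ge0 (A * B).
Proof. by move=> hA hB i; rewrite coefM sumr_ge0 // => j _; rewrite mulr_ge0. Qed.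

Lemma coef_ge0Z (c : R) A : 0 <= c -> coef_ge0 A -> coef_ge0 (c *: A).
Proof. by move=> c0 hA i; rewrite coefZ mulr_ge0. Qed.

Lemma coef_ge0X : coef_ge0 'X.
Proof. by move=> i; rewrite coefX ler0n. Qed.

Lemma coef_ge0_even A : coef_ge0 A -> coef_ge0 (even_poly A).
Proof. by move=> hA i; rewrite coef_even_poly. Qed.

Lemma coef_ge0_odd A : coef_ge0 A -> coef_ge0 (odd_poly A).
Proof. by move=> hA i; rewrite coef_odd_poly. Qed.

Lemma coef_ge0_add_eq0 A B : coef_ge0 A -> coef_ge0 B -> A + B = 0 -> A = 0.
Proof.
move=> hA hB /polyP E; apply/polyP => i; have /eqP := E i.
by rewrite coefD coef0 paddr_eq0 // => /andP[/eqP].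
Qed.

Lemma coef_ge0_comb_eq0 A B (l r : R) : coef_ge0 A -> coef_ge0 B ->
  0 < l -> 0 < r -> l *: A + r *: B = 0 -> A = 0 /\ B = 0.
Proof.
move=> hA hB l0 r0 E.
have lA := coef_ge0Z (ltW l0) hA; have rB := coef_ge0Z (ltW r0) hB.
have /eqP := coef_ge0_add_eq0 lA rB E; rewrite scaler_eq0 gt_eqF //= => /eqP ->.
rewrite addrC in E; have /eqP := coef_ge0_add_eq0 rB lA E.
by rewrite scaler_eq0 gt_eqF //= => /eqP ->.
Qed.

Lemma coef_ge0_parity A : coef_ge0 (odd_poly A) -> coef_ge0 (even_poly A) ->
  coef_ge0 A.
Proof.
move=> ho he i; rewrite -(odd_double_half i).
case: (odd i); first by rewrite add1n -coef_odd_poly.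
by rewrite add0n -coef_even_poly.
Qed.

End PolyEval.
(** * Interlacing zeros and interpolatory 1-cubes *)

Section Interlacing.
Variable R : realType.
Local Open Scope complex_scope.
Implicit Types (xs ts rs : seq R) (x : R[i]).

Definition root_prod rs x : R[i] := \prod_(r <- rs) (x - r%:C).

Lemma ev_sorted_roots (A : {poly R}) rs x : sorted_roots A rs ->
  ev A x = (lead_coef A)%:C * root_prod rs x.
Proof.
move=> [E _]; rewrite [in LHS]E evZ; congr (_ * _).
rewrite /ev rmorph_prod horner_prod; apply: eq_bigr => r _.
by rewrite rmorphB /= map_polyX map_polyC hornerXsubC.
Qed.

Lemma Im_subr x (r : R) : Im (x - r%:C) = Im x.
Proof. by case: x => ? ? /=; rewrite oppr0 addr0. Qed.

Lemma root_prod_neq0 rs x : 0 < Im x -> root_prod rs x != 0.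
Proof.
move=> x0; rewrite prodf_seq_neq0; apply/allP => r _; rewrite eq_complex negb_and Im_subr.
by rewrite (gt_eqF x0) orbT.
Qed.

Definition interlaced xs ts : Prop :=
  (size ts = (size xs).+1 /\
     forall i, (i < size xs)%N -> ts`_i <= xs`_i /\ xs`_i <= ts`_i.+1) \/
  (size ts = size xs /\
     forall i, (i < size xs)%N ->
       xs`_i <= ts`_i /\ ((i.+1 < size xs)%N -> ts`_i <= xs`_i.+1)).

(** As a real zero moves to the right, x - t turns counterclockwise and the cone spanned by 1 and x
    - t widens. *)
Lemma cone_shift x a b (t s : R) : t <= s ->
  cone (x - t%:C) a b -> cone (x - s%:C) a b.
Proof.
move=> ts [h1 h2]; split=> //.
have -> : cross b ((x - s%:C) * a) = cross b ((x - t%:C) * a) + (s - t) * cross a b.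
  by case: (x) (a) (b) => [? ?] [? ?] [? ?]; rewrite /cross /=; ring.
by apply: addr_ge0 => //; apply: mulr_ge0 => //; rewrite subr_ge0.
Qed.

Lemma cone_root_step x a b (t s : R) : t <= s ->
  cone (x - t%:C) a b -> cone (x - s%:C) b ((x - s%:C) * a).
Proof. by move=> le h; exact: cone_rot (cone_shift le h). Qed.

(** The zeros are consumed in increasing order, alternately from [xs] and [ts]; [t] is the last one
    consumed, and each step multiplies one side by its factor and exchanges the sides. At the end
    [t] is shifted to 0. *)
Lemma interlaced_cone_from x a b (t : R) xs ts :
  t <= 0 -> all (fun r => r <= 0) ts -> size ts = size xs ->
  (forall i, (i < size xs)%N ->
     xs`_i <= ts`_i /\ ((i.+1 < size xs)%N -> ts`_i <= xs`_i.+1)) ->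
  ((0 < size xs)%N -> t <= xs`_0) ->
  cone (x - t%:C) a b -> cone x (root_prod xs x * a) (root_prod ts x * b).
Proof.
elim: xs ts a b t => [|y xs IH] [|z ts] a b t //= t0.
  by move=> _ _ _ _ /(cone_shift t0); rewrite /root_prod !big_nil !mul1r subr0.
move=> /andP[z0 ts0] [sz] H Hy h; have {Hy} Hy := Hy isT.
have [yz Hz] := H 0%N isT.
have h2 := cone_root_step yz (cone_root_step Hy h).
have := IH ts _ _ _ z0 ts0 sz _ _ h2; rewrite /root_prod !big_cons.
rewrite !mulrA ![_ * (x - _)]mulrC; apply.
  by move=> i ii; apply: (H i.+1).
by move=> s0; apply: Hz.
Qed.

Lemma interlaced_cone x xs ts : 0 < Im x ->
  all (fun r => r <= 0) xs -> all (fun r => r <= 0) ts -> interlaced xs ts ->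
  cone x (root_prod xs x) (root_prod ts x).
Proof.
move=> x0 xs0 ts0 [[sz H]|[sz H]]; last first.
  rewrite -[root_prod xs x]mulr1 -[root_prod ts x]mulr1.
  apply: (interlaced_cone_from (t := xs`_0)) => //.
    by case: (xs) xs0 => [|? ?] //= /andP[].
  by apply: cone11; rewrite Im_subr.
(* Once the lowest zero [z] of the longer list is consumed, the rest has equal lengths and starts
   with a zero from [xs]. *)
case: ts ts0 sz H => [//|z ts] /= /andP[z0 ts0] [sz] H.
rewrite -[root_prod xs x]mulr1 {2}/root_prod big_cons [_ * \prod_(j <- _) _]mulrC.
apply: (interlaced_cone_from (t := z)) => //.
- by move=> i ii; split=> [|i1]; [case: (H i ii)|case: (H i.+1 i1)].
- by move=> s0; case: (H 0%N s0).
rewrite -[X in cone _ _ X]mulr1; apply: (cone_root_step (lexx z)).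
by apply: cone11; rewrite Im_subr.
Qed.

Lemma avoid_seq (a b : R) rs : a < b -> exists2 c, a < c < b & c \notin rs.
Proof.
elim: rs a b => [|y rs IH] a b ab.
  by exists ((a + b) / 2) => //; have [-> ->] := midf_lt ab.
have [m1 m2] := midf_lt ab; have [ym|my] := leP y ((a + b) / 2).
  have [c /andP[c1 c2] cN] := IH _ _ m2.
  exists c; first by rewrite (lt_trans m1 c1).
  by rewrite inE negb_or cN andbT gt_eqF // (le_lt_trans ym c1).
have [c /andP[c1 c2] cN] := IH _ _ m1.
exists c; first by rewrite c1 (lt_trans c2 m2).
by rewrite inE negb_or cN andbT lt_eqF // (lt_trans c2 my).
Qed.

Definition n_above (c : R) rs : nat := count (fun t => c < t) rs.

Lemma n_above_geq rs (c : R) i : sorted <=%R rs -> (i < size rs)%N ->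
  c < rs`_i -> (size rs - i <= n_above c rs)%N.
Proof.
move=> srt si ci; rewrite /n_above -[X in count _ X](cat_take_drop i) count_cat.
rewrite -size_drop; apply: leq_trans (leq_addl _ _).
suff -> : count (fun t => c < t) (drop i rs) = size (drop i rs) by [].
apply/eqP; rewrite -all_count; apply/(all_nthP 0) => j.
rewrite size_drop => jj; rewrite nth_drop; apply: lt_le_trans ci _.
by apply: (sorted_leq_nth le_trans lexx) => //; rewrite ?inE ?leq_addr //
  -?ltn_subRL //; rewrite inE -ltn_subRL.
Qed.

Lemma n_above_leq rs (c : R) i : sorted <=%R rs -> (i < size rs)%N ->
  rs`_i < c -> (n_above c rs <= size rs - i.+1)%N.
Proof.
move=> srt si ci; rewrite /n_above -[X in count _ X](cat_take_drop i.+1) count_cat.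
rewrite -size_drop (_ : count _ (take _ _) = 0%N) ?add0n ?count_size //.
apply/eqP; rewrite -leqn0 leqNgt -has_count; apply/negP => /(has_nthP 0)[j].
rewrite size_takel // => jj; rewrite nth_take // => cj.
have : rs`_j <= rs`_i by apply: (sorted_leq_nth le_trans lexx) => //;
  rewrite inE (leq_trans jj).
by move=> /(lt_le_trans cj)/(lt_trans ci); rewrite ltxx.
Qed.

(** A violated inequality between two neighbours leaves an open interval; at a point of it that is
    no zero, the two counts contradict the hypothesis. *)
Lemma interlaced_of_counts xs ts : sorted <=%R xs -> sorted <=%R ts ->
  all (fun r => r <= 0) xs -> all (fun r => r <= 0) ts ->
  (forall c : R, c < 0 -> c \notin xs -> c \notin ts ->
     (n_above c xs <= n_above c ts <=
      (n_above c xs).+1)%N) ->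
  interlaced xs ts.
Proof.
move=> sx st x0 t0 H.
have H' (a b : R) : a < b -> b <= 0 -> exists c : R, [/\ a < c, c < b &
    (n_above c xs <= n_above c ts <=
      (n_above c xs).+1)%N].
  move=> ab b0; have [c /andP[c1 c2]] := @avoid_seq a b (xs ++ ts) ab.
  rewrite mem_cat negb_or => /andP[cx ct]; exists c; split=> //.
  by apply: H => //; exact: lt_le_trans b0.
have xn i : (i < size xs)%N -> xs`_i <= 0 by move=> ?; apply: (all_nthP 0 x0).
have tn i : (i < size ts)%N -> ts`_i <= 0 by move=> ?; apply: (all_nthP 0 t0).
have sz : (size xs <= size ts <= (size xs).+1)%N.
  (* Below [m] there are no zeros, so the counts there are the lengths of the lists. *)
  pose S := \sum_(t <- xs ++ ts) `|t|; pose m := - S - 1.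
  have m0 : m < 0.
    by rewrite /m -opprD oppr_lt0 ltr_wpDl // sumr_ge0.
  have all_gt (c : R) : c < m -> forall s : seq R, {subset s <= xs ++ ts} ->
      n_above c s = size s.
    move=> cm s sub; apply/eqP; rewrite /n_above -all_count; apply/allP => t /sub tin.
    apply: lt_trans cm _; rewrite /m.
    have h1 : - t <= `|t| by rewrite -normrN ler_norm.
    have h2 : `|t| <= S.
      by rewrite /S (big_rem t) //= lerDl sumr_ge0.
    by clearbody S; lra.
  have m1 : m - 1 < m by rewrite ltrBlDr ltrDl.
  have [c [_ cm]] := H' _ _ m1 (ltW m0).
  by rewrite !(all_gt _ cm) // => t tin; rewrite mem_cat tin ?orbT.
case/andP: sz => sz1; rewrite leq_eqVlt => /orP[/eqP sz|sz2].
  left; split=> // i ii.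
  have ii1 : (i < size ts)%N by lia.
  have ii2 : (i.+1 < size ts)%N by lia.
  split; rewrite leNgt; apply/negP => lt.
    have [c [c1 c2 /andP[h1 h2]]] := H' _ _ lt (tn i ii1).
    by have := n_above_geq st ii1 c2; have := n_above_leq sx ii c1; lia.
  have [c [c1 c2 /andP[h1 h2]]] := H' _ _ lt (xn i ii).
  by have := n_above_geq sx ii c2; have := n_above_leq st ii2 c1; lia.
have sz : size ts = size xs by lia.
right; split=> // i ii; have ii1 : (i < size ts)%N by lia.
split=> [|ii2]; rewrite leNgt; apply/negP => lt.
  have [c [c1 c2 /andP[h1 h2]]] := H' _ _ lt (xn i ii).
  by have := n_above_geq sx ii c2; have := n_above_leq st ii1 c1; lia.
have [c [c1 c2 /andP[h1 h2]]] := H' _ _ lt (tn i ii1).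
by have := n_above_geq st ii1 c2; have := n_above_leq sx ii2 c1; lia.
Qed.

End Interlacing.

(** * Arguments along half circles *)

Section Angles.
Variable R : realType.
Local Open Scope complex_scope.
Implicit Types (xs ts rs : seq R) (x : R[i]) (phi theta b r : R).

Definition expi theta : R[i] := cos theta +i* sin theta.

Lemma expiD theta phi : expi (theta + phi) = expi theta * expi phi.
Proof.
apply/eqP; rewrite eq_complex /= cosD sinD; apply/andP; split; apply/eqP; ring.
Qed.

Lemma expi0 : expi 0 = 1.
Proof. by rewrite /expi cos0 sin0. Qed.

Lemma expiDpi theta : expi (theta + pi) = - expi theta.
Proof. by rewrite /expi cosDpi sinDpi. Qed.

Lemma expiBpi theta : expi (theta - pi) = - expi theta.
Proof. by rewrite -[in RHS](subrK pi theta) expiDpi opprK. Qed.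

Lemma expi_pi : expi pi = -1.
Proof. by rewrite -[pi]add0r expiDpi expi0. Qed.

Lemma polar_right (a b : R) : 0 < a ->
  exists2 rho : R, 0 < rho & a +i* b = rho%:C * expi (atan (b / a)).
Proof.
move=> a0; pose s := Num.sqrt (1 + (b / a) ^+ 2).
have s0 : 0 < s by rewrite sqrtr_gt0 ltr_pwDl ?sqr_ge0.
have cz : cos (atan (b / a)) != 0 by rewrite cos_atan invr_eq0 gt_eqF.
exists (a * s); first by rewrite mulr_gt0.
apply/eqP; rewrite eq_complex /= !mul0r subr0 addr0.
have -> : sin (atan (b / a)) = b / a * cos (atan (b / a)).
  by rewrite -{2}(atanK (b / a)) /tan divfK.
rewrite cos_atan -/s; apply/andP; split; apply/eqP; field;
  by rewrite ?(gt_eqF s0) ?(gt_eqF a0).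
Qed.

(* The argument of [r e^(i phi) + b] for [0 <= b], [b <> r]: it runs
   continuously from [0] at [phi = 0] to [pi] or [0] at [phi = pi], according
   as [b < r] or [r < b]. *)
Definition angle r b phi : R :=
  if b < r then phi + atan (- (b * sin phi) / (r + b * cos phi))
  else atan (r * sin phi / (b + r * cos phi)).

Lemma add_mulcos_gt0 r b phi : 0 <= b -> b < r -> 0 < r + b * cos phi.
Proof.
move=> b0 br; have := cos_geN1 phi => c.
have : - b <= b * cos phi by rewrite -mulrN1 ler_wpM2l.
lra.
Qed.

Lemma angle_polar r b phi : 0 < r -> 0 <= b -> b != r ->
  exists2 rho : R, 0 < rho &
    r%:C * expi phi + b%:C = rho%:C * expi (angle r b phi).
Proof.
move=> r0 b0 br; rewrite /angle; case: ltP => [lt|ge].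
  have p0 := add_mulcos_gt0 phi b0 lt.
  have [rho rho0 E] := polar_right (- (b * sin phi)) p0.
  exists rho => //; rewrite expiD mulrCA -E.
  apply/eqP; rewrite eq_complex /=; apply/andP; split; apply/eqP; last by ring.
  have := cos2Dsin2 phi => h; rewrite -[b in LHS]mulr1 -h; ring.
have lt : r < b by rewrite lt_neqAle eq_sym br.
have p0 := add_mulcos_gt0 phi (ltW r0) lt.
have [rho rho0 E] := polar_right (r * sin phi) p0.
exists rho => //; rewrite -E.
by apply/eqP; rewrite eq_complex /=; apply/andP; split; apply/eqP; ring.
Qed.

Lemma angle0 r b : angle r b 0 = 0.
Proof. by rewrite /angle sin0 !mulr0 oppr0 !mul0r atan0 addr0 if_same. Qed.

Lemma angle_pi r b : angle r b pi = if b < r then pi else 0.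
Proof. by rewrite /angle sinpi !mulr0 oppr0 !mul0r atan0 addr0. Qed.

Lemma continuous_angle r b : 0 < r -> 0 <= b -> b != r -> continuous (angle r b).
Proof.
move=> r0 b0 br phi; rewrite /angle; case: ltP => [lt|ge].
  have p0 := add_mulcos_gt0 phi b0 lt.
  apply: continuousD; first exact: cvg_id.
  apply: continuous_comp; last exact: continuous_atan.
  apply: continuousM.
    by apply: continuousN; apply: continuousM; [exact: cvg_cst|exact: continuous_sin].
  apply: continuousV; first by rewrite gt_eqF.
  apply: continuousD; first exact: cvg_cst.
  by apply: continuousM; [exact: cvg_cst|exact: continuous_cos].
have lt : r < b by rewrite lt_neqAle eq_sym br.
have p0 := add_mulcos_gt0 phi (ltW r0) lt.
apply: continuous_comp; last exact: continuous_atan.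
apply: continuousM.
  by apply: continuousM; [exact: cvg_cst|exact: continuous_sin].
apply: continuousV; first by rewrite gt_eqF.
apply: continuousD; first exact: cvg_cst.
by apply: continuousM; [exact: cvg_cst|exact: continuous_cos].
Qed.

Definition angle_sum r rs phi : R := \sum_(t <- rs) angle r (- t) phi.

Lemma angle_sum_polar r rs phi : 0 < r -> all (fun t => t <= 0) rs ->
  - r \notin rs ->
  exists2 rho : R, 0 < rho &
    root_prod rs (r%:C * expi phi) = rho%:C * expi (angle_sum r rs phi).
Proof.
move=> r0; rewrite /root_prod /angle_sum; elim: rs => [|t rs IH] /=.
  by move=> _ _; exists 1 => //; rewrite !big_nil expi0 mulr1.
move=> /andP[t0 rs0]; rewrite inE negb_or => /andP[tr rsr].
have [rho rho0 E] := IH rs0 rsr.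
have [| |s s0 E'] := @angle_polar r (- t) phi r0; first by rewrite oppr_ge0.
  by rewrite eqr_oppLR eq_sym.
exists (s * rho); first exact: mulr_gt0.
by rewrite !big_cons E expiD rmorphM /= -mulrACA -E' rmorphN.
Qed.

Lemma angle_sum0 r rs : angle_sum r rs 0 = 0.
Proof. by rewrite /angle_sum big1 // => t _; exact: angle0. Qed.

Lemma angle_sum_pi r rs : angle_sum r rs pi = pi *+ n_above (- r) rs.
Proof.
rewrite /angle_sum /n_above -sum1_count -[RHS]mulr_natr natr_sum mulr_sumr.
rewrite [RHS]big_mkcond; apply: eq_bigr => t _.
by rewrite angle_pi ltrNl; case: ifP; rewrite ?mulr1.
Qed.

Lemma continuous_angle_sum r rs : 0 < r -> all (fun t => t <= 0) rs ->
  - r \notin rs -> continuous (angle_sum r rs).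
Proof.
move=> r0; elim: rs => [|t rs IH] /=.
  move=> _ _; rewrite (_ : angle_sum r [::] = fun=> 0); first exact: cst_continuous.
  by apply: boolp.funext => phi; rewrite /angle_sum big_nil.
move=> /andP[t0 rs0]; rewrite inE negb_or => /andP[tr rsr].
rewrite (_ : angle_sum r (t :: rs) = fun phi => angle r (- t) phi + angle_sum r rs phi).
  move=> phi; apply: continuousD; last exact: IH.
  by apply: continuous_angle => //; [rewrite oppr_ge0|rewrite eqr_oppLR eq_sym].
by apply: boolp.funext => phi; rewrite /angle_sum big_cons.
Qed.

Lemma IVT_between (f : R -> R) (a b v : R) : a < b -> continuous f ->
  (f a - v) * (f b - v) < 0 -> exists2 c, a < c < b & f c = v.
Proof.
move=> ab fc sgn.
have [||c] := @IVT R f a b v (ltW ab); first exact: continuous_subspaceT.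
  have [le|le] := leP (f a) (f b); apply/andP; split; rewrite leNgt;
    apply/negP => lt; move: sgn; apply/negP; rewrite -leNgt.
  - by rewrite mulr_ge0 // subr_ge0 ltW // (lt_le_trans lt).
  - by rewrite mulr_le0 // subr_le0 ltW // (le_lt_trans le).
  - by rewrite mulr_ge0 // subr_ge0 ltW // (lt_trans lt).
  - by rewrite mulr_le0 // subr_le0 ltW // (lt_trans le).
rewrite in_itv /= => /andP[ac cb] E; exists c => //.
by rewrite !lt_def ac cb !andbT; apply/andP; split; apply: contraTneq sgn;
  [move=> EE; rewrite -E EE subrr mul0r ltxx
  |move=> EE; rewrite -E EE subrr mulr0 ltxx].
Qed.

(** On the half circle of radius - c, [th] is a continuous argument of the quotient of the two
    products; it runs from 0 to pi times the difference of the counts. Too large a difference forces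
    a negative real quotient inside the half plane, hence a vanishing combination. *)
Lemma counts_of_combinations xs ts :
  all (fun t => t <= 0) xs -> all (fun t => t <= 0) ts ->
  (forall x (l r : R), 0 < Im x -> 0 < l -> 0 < r ->
     l%:C * root_prod xs x + r%:C * root_prod ts x != 0 /\
     l%:C * root_prod ts x + r%:C * (x * root_prod xs x) != 0) ->
  forall c : R, c < 0 -> c \notin xs -> c \notin ts ->
    (n_above c xs <= n_above c ts <= (n_above c xs).+1)%N.
Proof.
move=> x0 t0 H c c0 cx ct; pose r := - c.
have r0 : 0 < r by rewrite oppr_gt0.
have rx : - r \notin xs by rewrite opprK.
have rt : - r \notin ts by rewrite opprK.
pose th phi := angle_sum r ts phi - angle_sum r xs phi.
have thc : continuous th.
  by move=> phi; apply: continuousB; apply: continuous_angle_sum.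
have th0 : th 0 = 0 by rewrite /th !angle_sum0 subrr.
have thpi : th pi = pi *+ n_above c ts - pi *+ n_above c xs.
  by rewrite /th !angle_sum_pi opprK.
have p0 : 0 < pi :> R := pi_gt0 R.
have Hx phi : 0 < phi -> phi < pi -> 0 < Im (r%:C * expi phi).
  by move=> h1 h2; rewrite /= mul0r addr0 mulr_gt0 // sin_gt0_pi // h1.
have pol phi : exists rho sigma : R, [/\ 0 < rho, 0 < sigma,
    root_prod xs (r%:C * expi phi) = rho%:C * expi (angle_sum r xs phi) &
    root_prod ts (r%:C * expi phi) =
      sigma%:C * (expi (angle_sum r xs phi) * expi (th phi))].
  have [rho rho0 Eu] := angle_sum_polar phi r0 x0 rx.
  have [sigma s0 Ev] := angle_sum_polar phi r0 t0 rt.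
  by exists rho, sigma; split=> //; rewrite -expiD /th addrC subrK.
rewrite leqNgt [X in _ && X]leqNgt; apply/andP; split; apply/negP => lt.
  (* With fewer zeros in [ts], th - phi goes from 0 to at most - 2 pi; where it equals - pi, the
     product over [ts] is a negative multiple of x times the product over [xs]. *)
  have [|||phi /andP[ph0 php] E] := @IVT_between (fun phi => th phi - phi) 0 pi (- pi).
  - exact: p0.
  - by move=> phi; apply: continuousB; [exact: thc|exact: cvg_id].
  - rewrite th0 thpi subr0 !opprK add0r pmulr_rlt0 //.
    have : pi *+ (n_above c ts).+1 <= pi *+ n_above c xs :> R by rewrite ler_pMn2l.
    by rewrite mulrS; lra.
  have [rho [sigma [rho0 s0 Eu Ev]]] := pol phi.
  have [_ /eqP] := H _ (rho * r) sigma (Hx _ ph0 php) (mulr_gt0 rho0 r0) s0.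
  apply; rewrite Eu Ev (_ : th phi = phi - pi); last by rewrite -E; ring.
  by rewrite expiBpi rmorphM /=; ring.
(* With at least two more zeros in [ts], [th] reaches at least 2 pi; where it equals pi, the two
   products are negative multiples of each other. *)
have [|phi /andP[ph0 php] E] := @IVT_between th 0 pi pi p0 thc.
  rewrite th0 thpi sub0r mulNr oppr_lt0 pmulr_rgt0 //.
  have : pi *+ (n_above c xs).+2 <= pi *+ n_above c ts :> R by rewrite ler_pMn2l.
  by rewrite !mulrS; lra.
have [rho [sigma [rho0 s0 Eu Ev]]] := pol phi.
have [/eqP + _] := H _ sigma rho (Hx _ ph0 php) s0 rho0.
by apply; rewrite Eu Ev E expi_pi; ring.
Qed.

End Angles.

(** * Interpolatory 1-cubes as cone conditions *)

Section Cubes.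
Variable R : realType.
Local Open Scope complex_scope.
Implicit Types (A B : {poly R}) (xs ts rs : seq R) (x : R[i]).

Lemma coef_ge0_lead A : coef_ge0 A -> A != 0 -> 0 < lead_coef A.
Proof. by move=> h A0; rewrite lt_def lead_coef_eq0 A0 h. Qed.

Lemma coef_ge0_horner_gt0 A (r : R) : coef_ge0 A -> A != 0 -> 0 < r -> 0 < A.[r].
Proof.
move=> h A0 r0; rewrite horner_coef.
have sz : (size A).-1.+1 = size A by rewrite prednK // size_poly_gt0.
rewrite -sz big_ord_recr /= ltr_wpDl //.
  by rewrite sumr_ge0 // => i _; rewrite mulr_ge0 // exprn_ge0 // ltW.
by rewrite mulr_gt0 ?exprn_gt0 // coef_ge0_lead.
Qed.

Lemma sorted_roots_nonpos A rs : coef_ge0 A -> A != 0 -> sorted_roots A rs ->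
  all (fun r => r <= 0) rs.
Proof.
move=> h A0 [E _]; apply/allP => r rin; rewrite leNgt; apply/negP => r0.
have := coef_ge0_horner_gt0 h A0 r0; rewrite E hornerZ horner_prod.
by rewrite (big_rem r) //= hornerXsubC subrr mul0r mulr0 ltxx.
Qed.

Lemma nonpos_rooted_coef_ge0 A : standard A -> nonpos_rooted A -> coef_ge0 A.
Proof.
have c0 : coef_ge0 (0 : {poly R}) by move=> i; rewrite coef0.
case=> [->//|l0] [->//|[rs [[-> _] /allP h]]].
apply: coef_ge0Z; first exact: ltW.
rewrite big_seq; elim/big_ind: _ => [|p q|r /h r0].
- by move=> i; rewrite coefC; case: ifP.
- exact: coef_ge0M.
- rewrite -polyCN; apply: coef_ge0D; first exact: coef_ge0X.
  by move=> i; rewrite coefC; case: ifP; rewrite ?oppr_ge0.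
Qed.

Lemma real_rooted_nonvanishing A : real_rooted A -> nonvanishing A.
Proof.
case=> rs h; have [->|A0] := eqVneq A 0; [by left|right=> x x0].
rewrite (ev_sorted_roots _ h) mulf_neq0 ?root_prod_neq0 //.
by rewrite eq_complex /= eqxx andbT lead_coef_eq0.
Qed.

Lemma interp_cube_elim A B : interp_cube A B ->
  [/\ coef_ge0 A, coef_ge0 B, nonvanishing A, nonvanishing B &
   forall x, 0 < Im x -> cone x (ev A x) (ev B x)].
Proof.
case=> sA sB nA nB [rA [rB h]].
have A0 := nonpos_rooted_coef_ge0 sA nA; have B0 := nonpos_rooted_coef_ge0 sB nB.
split=> //; try exact: real_rooted_nonvanishing.
move=> x x0; case: h => [->|[->|[xs [ts [hx [ht [Az [Bz h]]]]]]]].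
- by rewrite ev0; exact: cone0l.
- by rewrite ev0; exact: cone0r.
rewrite (ev_sorted_roots _ hx) (ev_sorted_roots _ ht).
apply: coneZ; [exact: A0|exact: B0|].
apply: interlaced_cone => //; [exact: sorted_roots_nonpos hx|].
exact: sorted_roots_nonpos ht.
Qed.

(** A nonconstant [A] has a complex zero, which is real: zeros in the upper half plane are excluded,
    and conjugation excludes the lower one. Dividing it out lowers the degree. *)
Lemma sorted_roots_exists A : nonvanishing A -> exists rs, sorted_roots A rs.
Proof.
case=> [->|]; first by exists [::]; split; rewrite // lead_coef0 scale0r.
move=> h; suff [rs E] : exists rs, A = lead_coef A *: \prod_(r <- rs) ('X - r%:P).
  exists (sort <=%R rs); split; last exact/sort_sorted/le_total.
  by rewrite [LHS]E; congr (_ *: _); apply/perm_big; rewrite perm_sym perm_sort.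
have [n sz] := ubnP (size A); elim: n A sz h => // n IH A sz h.
have [s1|s1] := eqVneq (size A) 1%N.
  exists [::]; rewrite big_nil; have /eqP/size_poly1P[c c0 ->] := s1.
  by rewrite lead_coefC -mul_polyC mulr1.
have /closed_rootP[z] : size (map_poly (real_complex R) A) != 1%N.
  by rewrite size_map_poly.
move=> rz; have Ez : ev A z = 0 by apply/eqP.
have [z0|z0|z0] := ltgtP 0 (Im z).
- by have := h z z0; rewrite Ez eqxx.
- have Ec : (map_poly (real_complex R) A) = map_poly (@conjc R) (map_poly (real_complex R) A).
    rewrite -map_poly_comp; apply: eq_map_poly => c /=.
    by rewrite oppr0.
  have := h z^*; rewrite /ev Ec horner_map /= -/(ev A z) Ez conjc0 eqxx.
  by case: (z) z0 => a b /= b0; rewrite oppr_gt0 => /(_ b0).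
have Er : z = (Re z)%:C by case: (z) z0 => a b /= <-.
have : root A (Re z).
  by move: Ez; rewrite Er /ev horner_map /= => /eqP; rewrite eq_complex /= eqxx andbT.
move=> /factor_theorem[q Eq].
have qz : q != 0.
  apply/eqP => q0; have := h 'i; rewrite Eq q0 mul0r ev0 eqxx /= ltr01.
  by move=> /(_ isT).
have [||rs E] := IH q.
- by move: sz; rewrite Eq size_Mmonic ?monicXsubC // size_XsubC addn2.
- by move=> x x0; have := h x x0; rewrite Eq evM mulf_eq0 negb_or => /andP[].
exists (Re z :: rs); rewrite Eq lead_coef_Mmonic ?monicXsubC // big_cons.
by rewrite [in LHS]E -scalerAl mulrC.
Qed.

Lemma nonpos_roots_exist A : coef_ge0 A -> nonvanishing A -> nonpos_rooted A.
Proof.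
move=> A0 /sorted_roots_exists[rs h]; have [->|Az] := eqVneq A 0; first by left.
by right; exists rs; split=> //; exact: sorted_roots_nonpos h.
Qed.

Lemma interlaced_of_combinations A B xs ts :
  coef_ge0 A -> coef_ge0 B -> A != 0 -> B != 0 ->
  sorted_roots A xs -> sorted_roots B ts ->
  (forall x (l r : R), 0 < Im x -> 0 < l -> 0 < r ->
     l%:C * ev A x + r%:C * ev B x != 0 /\
     l%:C * ev B x + r%:C * (x * ev A x) != 0) ->
  interlaced xs ts.
Proof.
move=> A0 B0 Az Bz hx ht H.
have [xs0 ts0] := (sorted_roots_nonpos A0 Az hx, sorted_roots_nonpos B0 Bz ht).
have [lA lB] := (coef_ge0_lead A0 Az, coef_ge0_lead B0 Bz).
have [[_ sx] [_ st]] := (hx, ht).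
apply: interlaced_of_counts => //; apply: counts_of_combinations => // x l r x0 l0 r0.
(* The weights absorb the leading coefficients, leaving combinations of monic products. *)
have [h1 _] := H x (l / lead_coef A) (r / lead_coef B) x0 (divr_gt0 l0 lA)
  (divr_gt0 r0 lB).
have [_ h2] := H x (l / lead_coef B) (r / lead_coef A) x0 (divr_gt0 l0 lB)
  (divr_gt0 r0 lA).
move: h1 h2; rewrite (ev_sorted_roots _ hx) (ev_sorted_roots _ ht).
by rewrite [x * _]mulrCA !mulrA -!rmorphM /= !divfK // gt_eqF.
Qed.

Lemma cone_of_combinations A B : coef_ge0 A -> coef_ge0 B ->
  nonvanishing A -> nonvanishing B ->
  (forall x (l r : R), 0 < Im x -> 0 < l -> 0 < r ->
     l%:C * ev A x + r%:C * ev B x != 0 /\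
     l%:C * ev B x + r%:C * (x * ev A x) != 0) ->
  forall x, 0 < Im x -> cone x (ev A x) (ev B x).
Proof.
move=> A0 B0 nA nB H x x0.
have [->|Az] := eqVneq A 0; first by rewrite ev0; exact: cone0l.
have [->|Bz] := eqVneq B 0; first by rewrite ev0; exact: cone0r.
have [xs hx] := sorted_roots_exists nA; have [ts ht] := sorted_roots_exists nB.
rewrite (ev_sorted_roots _ hx) (ev_sorted_roots _ ht).
apply: coneZ; [exact: A0|exact: B0|apply: interlaced_cone => //].
- exact: sorted_roots_nonpos hx.
- exact: sorted_roots_nonpos ht.
- exact: interlaced_of_combinations hx ht H.
Qed.

(** Converse of [interp_cube_elim]: by pointedness of the cone the positive combinations have no
    zero in the half plane, and counting zeros gives the interlacing. *)
Lemma interp_cube_intro A B : coef_ge0 A -> coef_ge0 B ->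
  nonvanishing A -> nonvanishing B ->
  (forall x, 0 < Im x -> cone x (ev A x) (ev B x)) -> interp_cube A B.
Proof.
move=> A0 B0 nA nB H.
have st (C : {poly R}) : coef_ge0 C -> standard C.
  by move=> C0; have [->|Cz] := eqVneq C 0; [left|right; exact: coef_ge0_lead].
split; [exact: st|exact: st|exact: nonpos_roots_exist|exact: nonpos_roots_exist|].
have [xs hx] := sorted_roots_exists nA; have [ts ht] := sorted_roots_exists nB.
split; first by exists xs.
split; first by exists ts.
have [->|Az] := eqVneq A 0; first by left.
have [->|Bz] := eqVneq B 0; first by right; left.
right; right; exists xs, ts; do 4![split=> //].
apply: (interlaced_of_combinations A0 B0 Az Bz hx ht) => x l r x0 l0 r0.
apply: cone_comb_neq0 => //; first exact: H.
by move=> [_ E]; case: nA => [/eqP|/(_ x x0)]; rewrite ?(negPf Az) ?E ?eqxx.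
Qed.

(* A real-rooted polynomial of bounded degree takes comparable values at the
   points of H: [|y - r| / |x - r|] is bounded uniformly in real [r]. *)
Lemma sqmod_real_rooted_le A rs x (K : R) n :
  (forall r : R, sqmod (1 - r%:C) <= K * sqmod (x - r%:C)) -> 1 <= K ->
  sorted_roots A rs -> (size A <= n)%N -> sqmod (ev A 1) <= K ^+ n * sqmod (ev A x).
Proof.
move=> HK K1 h sz; have [->|Az] := eqVneq A 0.
  by rewrite !ev0 /sqmod /= expr0n addr0 mulr0.
rewrite !(ev_sorted_roots _ h) !sqmodM mulrCA ler_wpM2l ?sqmod_ge0 //.
apply: (le_trans (_ : _ <= K ^+ size rs * sqmod (root_prod rs x))); last first.
  rewrite ler_wpM2r ?sqmod_ge0 // ler_weXn2l //; apply: leq_trans sz.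
  have [E _] := h; rewrite E size_scale ?lead_coef_eq0 //.
  by rewrite size_prod_XsubC.
elim: rs {h} => [|r rs IH]; first by rewrite /root_prod !big_nil expr0 mul1r.
rewrite /root_prod !big_cons !sqmodM exprS mulrACA.
by apply: ler_pM; rewrite ?sqmod_ge0.
Qed.

(** If A(x) = 0, then A + r B is of order r at [x] but tends to A(1) > 0 at 1, while real-rootedness
    keeps its two values comparable. *)
Lemma nonvanishing_limit A B : coef_ge0 A ->
  (forall r : R, 0 < r -> nonpos_rooted (A + r *: B)) -> nonvanishing A.
Proof.
move=> A0 H; have [->|Az] := eqVneq A 0; [by left|right=> x x0].
apply/negP => /eqP Ex.
(* From (1 - r)^2 <= 2 (Re x - r)^2 + 2 (1 - Re x)^2, whose last term is compared with (Im x)^2. *)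
pose K := 2 + 2 * (1 - Re x) ^+ 2 / Im x ^+ 2.
have q0 : 0 <= 2 * (1 - Re x) ^+ 2 / Im x ^+ 2.
  by apply: divr_ge0; [apply: mulr_ge0; [exact: ler0n|exact: sqr_ge0]|exact: sqr_ge0].
have K1 : 1 <= K by rewrite /K; lra.
have HK (r : R) : sqmod (1 - r%:C) <= K * sqmod (x - r%:C).
  have -> : sqmod (1 - r%:C) = (1 - r) ^+ 2.
    by rewrite /sqmod /= subr0 expr0n addr0.
  have -> : sqmod (x - r%:C) = (Re x - r) ^+ 2 + Im x ^+ 2.
    by case: (x) => ? ?; rewrite /sqmod /= subr0.
  have -> : K * ((Re x - r) ^+ 2 + Im x ^+ 2) = 2 * (Re x - r) ^+ 2 + 2 * Im x ^+ 2
     + 2 * (1 - Re x) ^+ 2 + 2 * (1 - Re x) ^+ 2 / Im x ^+ 2 * (Re x - r) ^+ 2.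
    by rewrite /K; field; rewrite gt_eqF.
  have := mulr_ge0 q0 (sqr_ge0 (Re x - r)).
  have := sqr_ge0 (Im x); have := sqr_ge0 (1 - Re x - (Re x - r)).
  by rewrite !expr2 => ? ? ?; lra.
pose n := maxn (size A) (size B).
have step (r : R) : 0 < r ->
    sqmod (ev A 1 + r%:C * ev B 1) <= K ^+ n * sqmod (r%:C * ev B x).
  move=> r0; rewrite -[r%:C * ev B x]add0r -Ex -!evZ -!evD.
  have [->|[rs [h _]]] := H r r0.
    by rewrite !ev0 /sqmod /= expr0n addr0 mulr0.
  apply: (sqmod_real_rooted_le HK K1 h).
  rewrite (leq_trans (size_polyD _ _)) // geq_max leq_maxl /=.
  by rewrite (leq_trans (size_scale_leq _ _)) // leq_maxr.
have ev1 (C : {poly R}) : ev C 1 = (C.[1])%:C by have := horner_map (real_complex R) C 1.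
have a0 : 0 < A.[1] by apply: coef_ge0_horner_gt0.
suff : 0 <= - A.[1] ^+ 2 by apply/negP; rewrite -ltNge oppr_lt0 exprn_gt0.
apply: (@quad_limit_ge0 _ _ (- 2 * A.[1] * B.[1])
  (K ^+ n * sqmod (ev B x) - B.[1] ^+ 2)) => r /step.
rewrite !ev1 -rmorphM -rmorphD /= -subr_ge0 !sqmodM; congr (0 <= _).
by rewrite !sqmod_real; ring.
Qed.

End Cubes.
(** * Interpolatory squares *)

Section Squares.
Variable R : realType.
Local Open Scope complex_scope.
Implicit Types (f g al de : {poly R}) (x : R[i]).

(* By the Hermite-Biehler theorem this says that [f] has no zero with positive
   real part; [x] stands for the square of the variable of [f]. *)
Definition hurwitz f : Prop :=
  [/\ coef_ge0 f,
      f = 0 \/ forall x, 0 < Im x ->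
        ~ (ev (even_poly f) x = 0 /\ ev (odd_poly f) x = 0)
    & forall x, 0 < Im x -> cone x (ev (odd_poly f) x) (ev (even_poly f) x)].

(* The squares in the definitions of amicable and very amicable pairs, with
   [de] = J^- and [al] = J^- + J^o, respectively J^o, where J^o belongs to the
   graph with identified vertices. *)
Definition parity_square al de : Prop :=
  interp_square (odd_poly al) (even_poly al) (even_poly de) ('X * odd_poly de).

(** These values are, up to a factor x, the polynomials in the two cubes of a square, which must
    have only real zeros. *)
Definition combinations_neq0 f : Prop :=
  f = 0 \/ forall x (l r : R), 0 < Im x -> 0 < l -> 0 < r ->
    l%:C * ev (odd_poly f) x + r%:C * ev (even_poly f) x != 0 /\
    l%:C * ev (even_poly f) x + r%:C * (x * ev (odd_poly f) x) != 0.

Lemma hurwitz_combinations f : hurwitz f -> combinations_neq0 f.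
Proof.
case=> _ [->|nz] h; [by left|right=> x l r x0 l0 r0].
by apply: cone_comb_neq0 => //; [exact: h|exact: nz].
Qed.

Lemma hurwitzM f g : hurwitz f -> hurwitz g -> hurwitz (f * g).
Proof.
move=> [f0 fz fc] [g0 gz gc]; split; first exact: coef_ge0M.
  case: fz gz => [->|fz] [->|gz]; rewrite ?mul0r ?mulr0; try by left.
  right=> x x0; rewrite even_polyM odd_polyM !(evD, evM, evX) => -[E1 E2].
  case: (cone_prod_eq0 x0 (fc x x0) (gc x x0) E1 E2).
    exact: fz.
  exact: gz.
move=> x x0; rewrite even_polyM odd_polyM !(evD, evM, evX) mulrA.
by apply: coneM; [exact: fc|exact: gc].
Qed.

Lemma real_cone x (l r : R) : 0 < Im x -> 0 < l -> 0 < r -> cone x r%:C l%:C.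
Proof.
move=> x0 l0 r0; have -> : cone x r%:C l%:C =
    (0 <= r * 0 - 0 * l /\ 0 <= l * (Im x * r) - 0 * (Re x * r)).
  by case: (x) => x1 x2; rewrite /cone /cross /= !mulr0 !add0r !subr0.
by rewrite mulr0 !mul0r !subr0 lexx !mulr_ge0 // ltW.
Qed.

(** The two cubes are the cases n = l / r and n = (r / l) x of the Moebius condition. *)
Lemma parity_square_intro al de :
  coef_ge0 al -> coef_ge0 de ->
  combinations_neq0 al -> combinations_neq0 de ->
  (forall x, 0 < Im x -> forall n0 n1 : R[i], cone x n1 n0 ->
    cone x (n0 * ev (odd_poly al) x + n1 * ev (even_poly al) x)
           (n0 * ev (even_poly de) x + n1 * (x * ev (odd_poly de) x))) ->
  parity_square al de.
Proof.
move=> al0 de0 alz dez H l r l0 r0.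
have lW := ltW l0; have rW := ltW r0.
have [a0 a1] := (coef_ge0_even al0, coef_ge0_odd al0).
have [d0 d1] := (coef_ge0_even de0, coef_ge0_odd de0).
split; apply: interp_cube_intro;
  try by apply: coef_ge0D; apply: coef_ge0Z => //; apply: coef_ge0M => //;
         apply: coef_ge0X.
- case: alz => [->|alz]; first by left; rewrite odd_polyC even_polyC !scaler0 addr0.
  by right=> x x0; rewrite evD !evZ; case: (alz x l r x0 l0 r0).
- case: dez => [->|dez].
    by left; rewrite odd_polyC even_polyC mulr0 !scaler0 addr0.
  by right=> x x0; rewrite evD !evZ evM evX; case: (dez x l r x0 l0 r0).
- move=> x x0; rewrite !evD !evZ evM evX; apply: H => //; exact: real_cone.
- case: alz => [->|alz].
    by left; rewrite odd_polyC even_polyC mulr0 !scaler0 addr0.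
  by right=> x x0; rewrite evD !evZ evM evX; case: (alz x l r x0 l0 r0).
- case: dez => [->|dez].
    by left; rewrite odd_polyC even_polyC !mulr0 !scaler0 addr0.
  (* This polynomial is x times the first combination of the parts of [de]. *)
  right=> x x0; have [N _] := dez x l r x0 l0 r0.
  have := mulf_neq0 (Im_neq0 x0) N; congr (_ != 0).
  by rewrite evD !evZ !evM !evX; ring.
- move=> x x0; rewrite !evD !evZ !evM !evX.
  have := H x x0 _ _ (cone_rot (real_cone x0 l0 r0)).
  by congr cone; ring.
Qed.

Lemma combination_coef_ge0 f g :
  (forall r : R, 0 < r -> coef_ge0 (f + r *: g)) -> coef_ge0 f.
Proof.
move=> H i; apply: (@quad_limit_ge0 _ _ (g`_i) 0) => r r0.
by have := H r r0 i; rewrite coefD coefZ mulr0 addr0.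
Qed.

(* The cone condition in a square holds for real combinations only; it bounds
   the zeros of the two sides, whence the cone condition for the sides. *)
Lemma combinations_cone f g :
  (forall l r : R, 0 < l -> 0 < r ->
    let p := l *: f + r *: g in let q := l *: g + r *: ('X * f) in
    [/\ coef_ge0 p, nonpos_rooted p & nonvanishing p] /\ nonvanishing q) ->
  [/\ coef_ge0 f, coef_ge0 g,
      forall x, 0 < Im x -> cone x (ev f x) (ev g x)
    & (f = 0 /\ g = 0) \/ forall x, 0 < Im x -> ~ (ev f x = 0 /\ ev g x = 0)].
Proof.
move=> H; have f0 : coef_ge0 f.
  apply: (@combination_coef_ge0 _ g) => r r0.
  by have [[+ _ _] _] := H 1 r ltr01 r0; rewrite scale1r.
have g0 : coef_ge0 g.
  apply: (@combination_coef_ge0 _ f) => r r0.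
  by have [[+ _ _] _] := H r 1 r0 ltr01; rewrite scale1r addrC.
have fz : nonvanishing f.
  apply: (@nonvanishing_limit _ _ g) => // r r0.
  by have [[_ + _] _] := H 1 r ltr01 r0; rewrite scale1r.
have gz : nonvanishing g.
  apply: (@nonvanishing_limit _ _ f) => // r r0.
  by have [[_ + _] _] := H r 1 r0 ltr01; rewrite scale1r addrC.
have z : (f = 0 /\ g = 0) \/ forall x (l r : R), 0 < Im x -> 0 < l -> 0 < r ->
    l%:C * ev f x + r%:C * ev g x != 0 /\
    l%:C * ev g x + r%:C * (x * ev f x) != 0.
  have [[-> ->]|N] : (f = 0 /\ g = 0) \/ ~ (f = 0 /\ g = 0).
    have [->|/eqP fN] := eqVneq f 0; last by right=> -[].
    by have [->|/eqP gN] := eqVneq g 0; [left|right=> -[]].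
    by left.
  right=> x l r x0 l0 r0; have [[_ _ z1] z2] := H l r l0 r0; split.
    case: z1 => [E|z1]; last by have := z1 x x0; rewrite evD !evZ.
    by case: N; apply: (coef_ge0_comb_eq0 _ _ l0 r0 E).
  case: z2 => [E|z2]; last by have := z2 x x0; rewrite evD !evZ evM evX.
  have [|g0' /eqP] := coef_ge0_comb_eq0 g0 _ l0 r0 E.
    by apply: coef_ge0M => //; exact: coef_ge0X.
  by rewrite mulf_eq0 polyX_eq0 /= => /eqP f0'; case: N.
split=> //.
  case: z => [[-> ->] x x0|z]; last exact: cone_of_combinations.
  by rewrite ev0 /cone mulr0 /cross !mul0r subrr.
case: z => [?|z]; [by left|right=> x x0 [E1 E2]].
by have [] := z x 1 1 x0 ltr01 ltr01; rewrite E1 E2 !mulr0 addr0 eqxx.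
Qed.

Lemma parity_square_elim al de : parity_square al de ->
  [/\ hurwitz al, hurwitz de & forall x, 0 < Im x ->
    point_square x (ev (even_poly al) x) (ev (odd_poly al) x)
                   (ev (even_poly de) x) (ev (odd_poly de) x)].
Proof.
move=> H.
have Ha l r (l0 : 0 < l) (r0 : 0 < r) :=
  (interp_cube_elim (H l r l0 r0).1, interp_cube_elim (H l r l0 r0).2).
have [a1 a0 ac az] : [/\ coef_ge0 (odd_poly al), coef_ge0 (even_poly al),
      forall x, 0 < Im x -> cone x (ev (odd_poly al) x) (ev (even_poly al) x)
    & (odd_poly al = 0 /\ even_poly al = 0) \/ forall x, 0 < Im x ->
        ~ (ev (odd_poly al) x = 0 /\ ev (even_poly al) x = 0)].
  apply: combinations_cone => l r l0 r0.
  have [[? _ ? _ _] [? _ ? _ _]] := Ha l r l0 r0.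
  by have [[_ _ ? _ _] [_ _ ? _ _]] := H l r l0 r0.
have [d1 d0 dc dz] : [/\ coef_ge0 (even_poly de), coef_ge0 ('X * odd_poly de),
      forall x, 0 < Im x -> cone x (ev (even_poly de) x) (ev ('X * odd_poly de) x)
    & (even_poly de = 0 /\ 'X * odd_poly de = 0) \/ forall x, 0 < Im x ->
        ~ (ev (even_poly de) x = 0 /\ ev ('X * odd_poly de) x = 0)].
  apply: combinations_cone => l r l0 r0.
  have [[_ ? _ ? _] [_ ? _ ? _]] := Ha l r l0 r0.
  by have [[_ _ _ ? _] [_ _ _ ? _]] := H l r l0 r0.
(* The square lists the parts of [de] rotated by x; the rotation is undone. *)
have dc' x : 0 < Im x -> cone x (ev (odd_poly de) x) (ev (even_poly de) x).
  move=> x0; apply: cone_unrot; first exact: Im_neq0.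
  by have := dc x x0; rewrite evM evX.
split; [split|split|].
- by apply: coef_ge0_parity.
- case: az => [[E1 E2]|az]; last by right=> x x0 [? ?]; apply: (az x x0).
  by left; rewrite -(poly_even_odd al) E1 E2 !comp_poly0 mul0r addr0.
- exact: ac.
- apply: coef_ge0_parity => // i.
  by have := d0 i.+1; rewrite coefXM.
- case: dz => [[E1 /eqP]|dz].
    rewrite mulf_eq0 polyX_eq0 /= => /eqP E2.
    by left; rewrite -(poly_even_odd de) E1 E2 !comp_poly0 mul0r addr0.
  by right=> x x0 [E1 E2]; apply: (dz x x0); rewrite evM E2 mulr0.
- exact: dc'.
move=> x x0; split; [exact: ac|exact: dc'|].
apply: (cone_square x0 (ac x x0)) => l r l0 r0.
  have [[_ _ _ _ h] _] := Ha l r l0 r0.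
  by have := h x x0; rewrite !evD !evZ evM evX.
have [_ [_ _ _ _ h]] := Ha l r l0 r0.
by have := h x x0; rewrite !evD !evZ !evM !evX.
Qed.

Lemma parity_square_mul f al de : hurwitz f -> parity_square al de ->
  parity_square (f * al) (f * de).
Proof.
move=> hf /parity_square_elim[ha hd H].
have [ha' hd'] := (hurwitzM hf ha, hurwitzM hf hd).
apply: parity_square_intro.
- by case: ha'.
- by case: hd'.
- exact: hurwitz_combinations.
- exact: hurwitz_combinations.
move=> x x0 n0 n1 hn; have [_ _ hc] := hf.
have [_ _] := point_square_mul (hc x x0) (H x x0).
by rewrite !even_polyM !odd_polyM !(evD, evM, evX); apply.
Qed.

(** The polynomial [k] bounds both [f] and [g] from the same side: the same combination of [k] lies
    in the cones over the corresponding combinations of [f] and [g], so these cannot cancel. *)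
Lemma combinations_neq0D f g k : hurwitz f -> hurwitz g -> hurwitz k ->
  (k = 0 -> f = 0 \/ g = 0) ->
  (forall x, 0 < Im x -> forall n0 n1 : R[i], cone x n1 n0 ->
     (cone x (n0 * ev (odd_poly f) x + n1 * ev (even_poly f) x)
        (n0 * ev (even_poly k) x + n1 * (x * ev (odd_poly k) x)) /\
     cone x (n0 * ev (odd_poly g) x + n1 * ev (even_poly g) x)
        (n0 * ev (even_poly k) x + n1 * (x * ev (odd_poly k) x)))) ->
  combinations_neq0 (f + g).
Proof.
move=> hf hg hk kz H.
have [fE|fN] := eqVneq f 0; first by rewrite fE add0r; exact: hurwitz_combinations.
have [gE|gN] := eqVneq g 0; first by rewrite gE addr0; exact: hurwitz_combinations.
have kN : k != 0 by apply/eqP => /kz[] /eqP; apply/negP.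
right=> x l r x0 l0 r0.
have [E|F] := hurwitz_combinations hf; first by rewrite E eqxx in fN.
have [E|K] := hurwitz_combinations hk; first by rewrite E eqxx in kN.
have [[f1 f2] [k1 k2]] := (F x l r x0 l0 r0, K x l r x0 l0 r0).
have [p1 p2] := H x x0 _ _ (real_cone x0 l0 r0).
have [q1 q2] := H x x0 _ _ (cone_rot (real_cone x0 l0 r0)).
have xz := Im_neq0 x0.
rewrite !even_polyD !odd_polyD !evD; split; apply/eqP => E.
  have [] := @cone_addl_eq0 _ x _ _ _ x0 k2 p1 p2.
    by rewrite -[RHS]E; ring.
  by move=> Z; move/eqP: f1.
have k1' : x * (l%:C * ev (odd_poly k) x + r%:C * ev (even_poly k) x) != 0.
  by rewrite mulf_neq0.
have [] := @cone_addl_eq0 _ x _ (l%:C * ev (even_poly f) x + r%:C * (x * ev (odd_poly f) x)) (l%:C * ev (even_poly g) x + r%:C * (x * ev (odd_poly g) x)) x0 k1'.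
- by move: q1; congr cone; ring.
- by move: q2; congr cone; ring.
- by rewrite -[RHS]E; ring.
by move=> Z; move/eqP: f2.
Qed.

Section Compositions.
Variables (al de al' de' : {poly R}).
Hypothesis h : parity_square al de.
Hypothesis h' : parity_square al' de'.

Lemma parity_square_par :
  parity_square (al * al' + de * de') (de * al' + al * de').
Proof.
have [ha hd H] := parity_square_elim h.
have [ha' hd' H'] := parity_square_elim h'.
have hM := hurwitzM.
have [[[[a0 _ _] [d0 _ _]] [a0' _ _]] [d0' _ _]] := (ha, hd, ha', hd').
have cM := coef_ge0M.
apply: parity_square_intro.
- by apply: coef_ge0D; apply: cM.
- by apply: coef_ge0D; apply: cM.
(* The common bound of alpha alpha' and delta delta' is delta alpha'. *)
- apply: (@combinations_neq0D _ _ (de * al')); try exact: hM.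
    move=> /eqP; rewrite mulf_eq0 => /orP[/eqP->|/eqP->]; rewrite ?mul0r ?mulr0;
      by auto.
  move=> x x0 n0 n1 hn.
  have [p1 p2 p3 p4] := point_square_cross (Im_neq0 x0) (H x x0) (H' x x0) hn.
  by rewrite !even_polyM !odd_polyM !(evD, evM, evX).
(* The common bound of delta alpha' and alpha delta' is alpha alpha', after a rotation. *)
- apply: (@combinations_neq0D _ _ (al * al')); try exact: hM.
    move=> /eqP; rewrite mulf_eq0 => /orP[/eqP->|/eqP->]; rewrite ?mul0r ?mulr0;
      by auto.
  move=> x x0 n0 n1 hn.
  have [p1 p2 _ _] := point_square_cross (Im_neq0 x0) (H x x0) (H' x x0)
    (cone_rot hn).
  rewrite !even_polyM !odd_polyM !(evD, evM, evX).
  split; apply: cone_unrot; try exact: Im_neq0.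
    by move: p1; congr cone; ring.
  by move: p2; congr cone; ring.
move=> x x0 n0 n1 hn.
have := point_square_par (Im_neq0 x0) (H x x0) (H' x x0) hn.
by rewrite !(even_polyD, odd_polyD) !even_polyM !odd_polyM !(evD, evM, evX).
Qed.

Lemma parity_square_ser : parity_square (de * al' + al * de') (de * de').
Proof.
have [ha hd H] := parity_square_elim h.
have [ha' hd' H'] := parity_square_elim h'.
have hM := hurwitzM.
have [[[[a0 _ _] [d0 _ _]] [a0' _ _]] [d0' _ _]] := (ha, hd, ha', hd').
have cM := coef_ge0M.
apply: parity_square_intro.
- by apply: coef_ge0D; apply: cM.
- exact: cM.
- apply: (@combinations_neq0D _ _ (de * de')); try exact: hM.
    move=> /eqP; rewrite mulf_eq0 => /orP[/eqP->|/eqP->]; rewrite ?mul0r ?mulr0;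
      by auto.
  move=> x x0 n0 n1 hn.
  have := point_square_ser_cross (H x x0) (H' x x0) hn.
  by rewrite !even_polyM !odd_polyM !(evD, evM, evX).
- by apply: hurwitz_combinations; apply: hM.
move=> x x0 n0 n1 hn.
have := point_square_ser (H x x0) (H' x x0) hn.
by rewrite !(even_polyD, odd_polyD) !even_polyM !odd_polyM !(evD, evM, evX).
Qed.

End Compositions.

(* A single edge, for which [alpha = u] and [delta = 1]. *)
Lemma parity_square_edge : parity_square 'X 1.
Proof.
have eX : even_poly 'X = 0 :> {poly R}.
  by rewrite -['X]mul1r even_polyMX odd_polyC mul0r.
have oX : odd_poly 'X = 1 :> {poly R}.
  by rewrite -['X]mul1r odd_polyMX even_polyC.
have e1 : even_poly 1 = 1 :> {poly R} by rewrite even_polyC.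
have o1 : odd_poly 1 = 0 :> {poly R} by rewrite odd_polyC.
have ev1 x : ev (1 : {poly R}) x = 1 by rewrite evC rmorph1.
have n0 (r : R) : 0 < r -> r%:C != 0 by move=> r0; rewrite eq_complex /= gt_eqF.
apply: parity_square_intro.
- exact: coef_ge0X.
- by move=> i; rewrite coefC; case: ifP.
- right=> x l r x0 l0 r0; rewrite eX oX ev0 ev1 !mulr0 !mulr1 addr0 add0r.
  by rewrite mulf_neq0 ?n0 ?Im_neq0.
- right=> x l r x0 l0 r0; rewrite e1 o1 ev0 ev1 !mulr0 !mulr1 addr0 add0r.
  by rewrite !n0.
move=> x x0 m0 m1 hn; rewrite eX oX e1 o1 ev0 ev1 !mulr0 !mulr1 !addr0.
by have := cone_scale m0 (cone11 x0); rewrite mulr1.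
Qed.

Lemma parity_square_add_edge al de : parity_square al de ->
  parity_square ('X * al + de) ('X * de + al).
Proof.
move=> /(parity_square_par parity_square_edge).
by rewrite !mul1r addrC [_ + 'X * de]addrC [de + _]addrC.
Qed.

End Squares.
(** * Connectivity by edge lists *)

Section EdgeConnectivity.
Variable T : finType.
Implicit Types (V : {set T}) (E F S : seq (T * T)) (x y a b v w : T).

Definition adj E : rel T := fun x y => ((x, y) \in E) || ((y, x) \in E).

Definition conn V E : bool :=
  [forall x in V, forall y in V, connect (adj E) x y].

Lemma connP V E :
  reflect {in V &, forall x y, connect (adj E) x y} (conn V E).
Proof.
apply: (iffP forall_inP) => [H x y xV yV|H x xV].
  by have /forall_inP := H x xV; apply.
by apply/forall_inP => y yV; exact: H.
Qed.

Lemma connect_adj_sym E x y : connect (adj E) x y = connect (adj E) y x.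
Proof. by apply: sym_connect_sym => a b; rewrite /adj orbC. Qed.

Lemma connect_adj_edge E x y : (x, y) \in E -> connect (adj E) x y.
Proof. by move=> xy; apply: connect1; rewrite /adj xy. Qed.

Lemma connect_adj_ind E (r : T -> T -> Prop) :
  (forall x, r x x) -> (forall x y, r x y -> r y x) ->
  (forall y x z, r x y -> r y z -> r x z) ->
  (forall x y, (x, y) \in E -> r x y) ->
  forall x y, connect (adj E) x y -> r x y.
Proof.
move=> rr rs rt rE x y /connectP[p]; elim: p x => [|z p IH] x /=.
  by move=> _ ->.
move=> /andP[xz pz] yE; apply: (rt z); last exact: IH.
by case/orP: xz => [/rE|/rE/rs].
Qed.

Lemma connect_adj_map (f : T -> T) E F :
  (forall x y, (x, y) \in E -> connect (adj F) (f x) (f y)) ->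
  forall x y, connect (adj E) x y -> connect (adj F) (f x) (f y).
Proof.
move=> H; apply: connect_adj_ind => //.
- by move=> x y; rewrite connect_adj_sym.
- by move=> y x z; exact: connect_trans.
Qed.

Lemma connect_adj_sub E F : {subset E <= F} ->
  forall x y, connect (adj E) x y -> connect (adj F) x y.
Proof.
by move=> sub; apply: (connect_adj_map (f := id)) => x y /sub/connect_adj_edge.
Qed.

Lemma conn_generate V E F :
  (forall x y, (x, y) \in E -> connect (adj F) x y) -> conn V E -> conn V F.
Proof.
move=> sub /connP H; apply/connP => x y xV yV.
exact: (connect_adj_map (f := id)) (H x y xV yV).
Qed.

Lemma conn_sub V E F : {subset E <= F} -> conn V E -> conn V F.
Proof.
move=> sub /connP H; apply/connP => x y xV yV.
exact: (connect_adj_sub sub (H x y xV yV)).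
Qed.

Lemma eq_conn V E F : E =i F -> conn V E = conn V F.
Proof. by move=> EF; apply/idP/idP; apply: conn_sub => e; rewrite EF. Qed.

(** Contracting one edge loses at most one vertex and keeps connectivity. The bound makes the
    exponents of 1 - q in H nonnegative. *)
Lemma conn_card V E : conn V E -> (#|V| <= (size E).+1)%N.
Proof.
have [n sz] := ubnP (size E); elim: n => // n IH in V E sz *.
case: E sz => [_|[a b] E sz] /connP H.
  apply/card_le1P => x xV y; apply/idP/idP => [yV|/eqP->//].
  have /connectP[[|z p] //=] := H x y xV yV; first by move=> _ ->; rewrite inE.
pose f x := if x == b then a else x.
pose F := [seq (f e.1, f e.2) | e <- E].
have HF : conn [set f x | x in V] F.
  apply/connP => _ _ /imsetP[x xV ->] /imsetP[y yV ->].
  apply: connect_adj_map (H x y xV yV) => {x y xV yV} x y.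
  rewrite inE => /orP[/eqP[-> ->]|xy].
    by rewrite /f eqxx; case: ifP => //; rewrite connect0.
  by apply: connect_adj_edge; apply/mapP; exists (x, y).
have := IH _ _ _ HF; rewrite size_map => /(_ sz) h.
rewrite (cardsD1 b V); apply: (@leq_add _ _ 1 (size E).+1); first exact: leq_b1.
apply: leq_trans h; apply: subset_leq_card; apply/subsetP => x.
rewrite !inE => /andP[xb xV]; apply/imsetP; exists x => //.
by rewrite /f (negPf xb).
Qed.

Definition edges_in V E : Prop := forall e, e \in E -> e.1 \in V /\ e.2 \in V.

(* Retract onto the side [V], collapsing the other side to [v]. *)
Lemma connect_retract V v E F :
  edges_in V E -> (forall e, e \in F -> (e.1 \in V -> e.1 = v) /\ (e.2 \in V -> e.2 = v)) ->
  v \in V -> {in V &, forall x y, connect (adj (E ++ F)) x y -> connect (adj E) x y}.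
Proof.
move=> EV FV vV x y xV yV; pose f z := if z \in V then z else v.
move=> /(connect_adj_map (f := f) (F := E)); rewrite /f xV yV; apply.
move=> a b; rewrite mem_cat => /orP[ab|ab].
  by have [/= -> ->] := EV _ ab; exact: connect_adj_edge.
have [/= h1 h2] := FV _ ab.
by case: ifP => [/h1->|_]; case: ifP => [/h2->|_]; rewrite connect0.
Qed.

Lemma conn_union_vertex V1 V2 v E F :
  V1 :&: V2 = [set v] -> edges_in V1 E -> edges_in V2 F ->
  conn (V1 :|: V2) (E ++ F) = conn V1 E && conn V2 F.
Proof.
move=> V12 E1 F2.
have : v \in V1 :&: V2 by rewrite V12 set11.
rewrite inE => /andP[v1 v2].
have only x : x \in V1 -> x \in V2 -> x = v.
  by move=> x1 x2; apply/set1P; rewrite -V12 inE x1.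
apply/idP/andP => [/connP H|[/connP H1 /connP H2]].
  split; apply/connP => x y xV yV.
    apply: (connect_retract (V := V1) (v := v) (F := F)) => //.
      by move=> e /F2[h1 h2]; split=> ?; apply: only.
    by apply: H; rewrite inE ?xV ?yV.
  apply: (connect_retract (V := V2) (v := v) (F := E)) => //.
    by move=> e /E1[h1 h2]; split=> ?; apply: only.
  apply: (connect_adj_sub (E := E ++ F)); first by move=> e; rewrite !mem_cat orbC.
  by apply: H; rewrite inE ?xV ?yV orbT.
have toE := @connect_adj_sub E (E ++ F); have toF := @connect_adj_sub F (E ++ F).
have cv x : x \in V1 :|: V2 -> connect (adj (E ++ F)) x v.
  rewrite inE => /orP[xV|xV].
    by apply: toE (H1 x v xV v1) => e; rewrite mem_cat => ->.
  by apply: toF (H2 x v xV v2) => e; rewrite mem_cat orbC => ->.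
apply/connP => x y /cv xv /cv; rewrite connect_adj_sym; exact: connect_trans.
Qed.

Definition relabel a b x := if x == b then a else x.

Definition relabel_edges a b E := [seq (relabel a b e.1, relabel a b e.2) | e <- E].

(** The edge (v, w) joins each vertex to its relabelling, and conversely relabelling turns this edge
    into a loop at [v]. *)
Lemma conn_identify V v w E : v \in V -> v != w ->
  conn (V :\ w) (relabel_edges v w E) = conn V ((v, w) :: E).
Proof.
move=> vV vw; apply/connP/connP => H x y.
  move=> xV yV; set F := (v, w) :: E.
  have cr z : connect (adj F) z (relabel v w z).
    rewrite /relabel; case: eqP => [->|_]; last exact: connect0.
    by rewrite connect_adj_sym; apply: connect_adj_edge; rewrite inE eqxx.
  have rV z : z \in V -> relabel v w z \in V :\ w.
    by rewrite /relabel; case: eqP => [_|/eqP zw] zV; rewrite !inE ?vw ?zw.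
  apply: (connect_trans (cr x)); rewrite connect_adj_sym.
  apply: (connect_trans (cr y)); rewrite connect_adj_sym.
  move: (H _ _ (rV x xV) (rV y yV)).
  apply: (connect_adj_map (f := id)) => _ _ /mapP[[a b] ab [-> ->]] /=.
  apply: (connect_trans (_ : connect _ _ a)); first by rewrite connect_adj_sym.
  apply: connect_trans (cr b).
  by apply: connect_adj_edge; rewrite inE ab orbT.
rewrite !inE => /andP[xw xV] /andP[yw yV].
have /(connect_adj_map (f := relabel v w) (F := relabel_edges v w E)) := H x y xV yV.
rewrite {3 4}/relabel (negPf xw) (negPf yw); apply=> a b.
rewrite inE => /orP[/eqP[-> ->]|ab].
  by rewrite /relabel (negPf vw) eqxx connect0.
by apply: connect_adj_edge; apply/mapP; exists (a, b).
Qed.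

Section TwoVertices.
Variables (V1 V2 : {set T}) (v w1 w2 : T) (E F : seq (T * T)).
Hypotheses (V12 : V1 :&: V2 = [set v]) (E1 : edges_in V1 E) (F2 : edges_in V2 F).
Hypotheses (w1V : w1 \in V1) (w1v : w1 != v) (w2V : w2 \in V2) (w2v : w2 != v).

Lemma common_vertex : v \in V1 /\ v \in V2.
Proof.
by have : v \in V1 :&: V2; [rewrite V12 set11|rewrite inE => /andP].
Qed.

Lemma common_vertex_only x : x \in V1 -> x \in V2 -> x = v.
Proof. by move=> x1 x2; apply/set1P; rewrite -V12 inE x1. Qed.

(** In the presence of (v, w1), the edge (w1, w2) may be replaced by (v, w2); the resulting union is
    cut at [v]. *)
Lemma conn_parallel_joined :
  conn (V1 :|: V2) [:: (w1, w2), (v, w1) & E ++ F] =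
  conn V1 ((v, w1) :: E) && conn V2 ((v, w2) :: F).
Proof.
have [v1 v2] := common_vertex.
rewrite -(@conn_union_vertex V1 V2 v) //; last first.
- by move=> e; rewrite inE => /orP[/eqP->|/F2].
- by move=> e; rewrite inE => /orP[/eqP->|/E1].
apply/idP/idP; apply: conn_generate => x y; rewrite /= !(inE, mem_cat).
  case/or4P => [/eqP[-> ->]|/eqP[-> ->]|xy|xy].
  - apply: (connect_trans (y := v)).
      by rewrite connect_adj_sym; apply: connect_adj_edge; rewrite inE eqxx.
    by apply: connect_adj_edge; rewrite !(inE, mem_cat) eqxx !orbT.
  - by apply: connect_adj_edge; rewrite inE eqxx.
  - by apply: connect_adj_edge; rewrite !(inE, mem_cat) xy !orbT.
  - by apply: connect_adj_edge; rewrite !(inE, mem_cat) xy !orbT.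
case/or4P => [/eqP[-> ->]|xy|/eqP[-> ->]|xy].
- by apply: connect_adj_edge; rewrite !inE eqxx orbT.
- by apply: connect_adj_edge; rewrite !(inE, mem_cat) xy !orbT.
- apply: (connect_trans (y := w1)); apply: connect_adj_edge;
    by rewrite !inE eqxx ?orbT.
- by apply: connect_adj_edge; rewrite !(inE, mem_cat) xy !orbT.
Qed.

(* Were [v] joined neither to [w1] in [E] nor to [w2] in [F], the vertices
   joined to [v] within their side would be separated from [w1]. *)
Lemma connect_parallel_split :
  connect (adj ((w1, w2) :: E ++ F)) v w1 ->
  connect (adj E) v w1 || connect (adj F) v w2.
Proof.
have [v1 v2] := common_vertex.
apply: contraLR; rewrite negb_or => /andP[n1 n2]; apply/negP => C.
pose P x := if x \in V1 then connect (adj E) v x else connect (adj F) v x.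
have PF x : x \in V2 -> P x = connect (adj F) v x.
  rewrite /P; case: ifP => // x1 x2.
  by rewrite (common_vertex_only x1 x2) !connect0.
have /(_ C) : connect (adj ((w1, w2) :: E ++ F)) v w1 -> P v = P w1.
  apply: (connect_adj_ind (r := fun x y => P x = P y)) => //.
  - by move=> y x z -> ->.
  - move=> x y; rewrite inE mem_cat => /or3P[/eqP[-> ->]|xy|xy].
    + by rewrite (PF w2) // /P w1V (negPf n1) (negPf n2).
    + have [/= x1 y1] := E1 xy; rewrite /P x1 y1.
      have xy' := connect_adj_edge xy; apply/idP/idP => h.
        exact: connect_trans xy'.
      by apply: connect_trans h _; rewrite connect_adj_sym.
    + have [/= x1 y1] := F2 xy; rewrite !PF //.
      have xy' := connect_adj_edge xy; apply/idP/idP => h.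
        exact: connect_trans xy'.
      by apply: connect_trans h _; rewrite connect_adj_sym.
by rewrite /P v1 w1V (negPf n1) connect0.
Qed.

Lemma conn_absorb V w S : connect (adj S) v w -> conn V ((v, w) :: S) -> conn V S.
Proof.
move=> vw; apply: conn_generate => x y; rewrite inE => /orP[/eqP[-> ->]//|].
exact: connect_adj_edge.
Qed.

(** One side must join [v] to its second terminal by itself, by [connect_parallel_split]; the other
    side may use that connection as an extra edge. *)
Lemma conn_parallel :
  conn (V1 :|: V2) ((w1, w2) :: E ++ F) =
  (conn V1 E && conn V2 ((v, w2) :: F)) || (conn V1 ((v, w1) :: E) && conn V2 F).
Proof.
have [v1 v2] := common_vertex.
apply/idP/orP => [C|].
  have : conn (V1 :|: V2) [:: (w1, w2), (v, w1) & E ++ F].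
    by apply: conn_sub C => e; rewrite !inE => /orP[->//|->]; rewrite !orbT.
  rewrite conn_parallel_joined => /andP[c1 c2].
  have /connect_parallel_split/orP[h|h] : connect (adj ((w1, w2) :: E ++ F)) v w1.
    by move/connP: C; apply; rewrite inE ?v1 ?w1V.
  - by left; rewrite c2 (conn_absorb h c1).
  - by right; rewrite c1 (conn_absorb h c2).
have sE x y : connect (adj E) x y -> connect (adj ((w1, w2) :: E ++ F)) x y.
  by apply: connect_adj_sub => e; rewrite inE mem_cat => ->; rewrite orbT.
have sF x y : connect (adj F) x y -> connect (adj ((w1, w2) :: E ++ F)) x y.
  by apply: connect_adj_sub => e; rewrite inE mem_cat => ->; rewrite !orbT.
have e12 : connect (adj ((w1, w2) :: E ++ F)) w1 w2.
  by apply: connect_adj_edge; rewrite inE eqxx.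
case=> /andP[c1 c2].
  have : conn (V1 :|: V2) (E ++ (v, w2) :: F).
    rewrite (@conn_union_vertex V1 V2 v) ?c1 //.
    by move=> e; rewrite inE => /orP[/eqP->|/F2].
  apply: conn_generate => x y; rewrite mem_cat inE => /or3P[xy|/eqP[-> ->]|xy].
  - by apply: sE; exact: connect_adj_edge.
  - by apply: connect_trans e12; apply: sE; move/connP: c1; apply.
  - by apply: sF; exact: connect_adj_edge.
have : conn (V1 :|: V2) (((v, w1) :: E) ++ F).
  rewrite (@conn_union_vertex V1 V2 v) ?c1 //.
  by move=> e; rewrite inE => /orP[/eqP->|/E1].
apply: conn_generate => x y; rewrite mem_cat inE -orbA => /or3P[/eqP[-> ->]|xy|xy].
- apply: (connect_trans (y := w2)); last by rewrite connect_adj_sym.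
  by apply: sF; move/connP: c2; apply.
- by apply: sE; exact: connect_adj_edge.
- by apply: sF; exact: connect_adj_edge.
Qed.

End TwoVertices.

End EdgeConnectivity.
(** * Sums over sets of edges and the polynomial J *)

Section EdgeSums.
Variables (R : realType) (T : finType).
Implicit Types (V : {set T}) (E F S : seq (T * T)) (phi : seq (T * T) -> {poly R}).

(** Recursive form of the sum over edge sets S of (-2)^|S| (1 + u)^(m - |S|) phi(S), suited to
    inductions on the edges; the closed form is [edge_sumE]. *)
Fixpoint edge_sum phi E : {poly R} :=
  if E is e :: E' then
    (1 + 'X) * edge_sum phi E' - 2%:R * edge_sum (fun S => phi (e :: S)) E'
  else phi [::].

Lemma edge_sum_cons phi e E : edge_sum phi (e :: E) =
  (1 + 'X) * edge_sum phi E - 2%:R * edge_sum (fun S => phi (e :: S)) E.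
Proof. by []. Qed.

Lemma edge_sum_ext phi psi E :
  (forall S, {subset S <= E} -> phi S = psi S) -> edge_sum phi E = edge_sum psi E.
Proof.
elim: E phi psi => [|e E IH] phi psi H /=; first by rewrite H.
congr (_ * _ - _ * _); apply: IH => S sub; apply: H => x.
  by rewrite inE => /sub ->; rewrite orbT.
by rewrite !inE => /orP[->//|/sub ->]; rewrite orbT.
Qed.

Lemma eq_edge_sum phi psi E : phi =1 psi -> edge_sum phi E = edge_sum psi E.
Proof. by move=> H; apply: edge_sum_ext. Qed.

Lemma edge_sumD phi psi E :
  edge_sum (fun S => phi S + psi S) E = edge_sum phi E + edge_sum psi E.
Proof. by elim: E phi psi => [//|e E IH] phi psi /=; rewrite !IH; ring. Qed.

Lemma edge_sumMl (p : {poly R}) phi E :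
  edge_sum (fun S => p * phi S) E = p * edge_sum phi E.
Proof. by elim: E phi => [//|e E IH] phi /=; rewrite !IH; ring. Qed.

Lemma edge_sum_cat phi E F :
  edge_sum phi (E ++ F) =
  edge_sum (fun S1 => edge_sum (fun S2 => phi (S1 ++ S2)) F) E.
Proof. by elim: E phi => [//|e E IH] phi /=; rewrite !IH. Qed.

Lemma edge_sum_prod phi psi chi E F :
  (forall S1 S2, {subset S1 <= E} -> {subset S2 <= F} ->
     chi (S1 ++ S2) = phi S1 * psi S2) ->
  edge_sum chi (E ++ F) = edge_sum phi E * edge_sum psi F.
Proof.
move=> H; rewrite edge_sum_cat mulrC -edge_sumMl; apply: edge_sum_ext => S1 s1.
by rewrite mulrC -edge_sumMl; apply: edge_sum_ext => S2 s2; exact: H.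
Qed.

Lemma edge_sum_map (g : T * T -> T * T) phi E :
  edge_sum phi (map g E) = edge_sum (fun S => phi (map g S)) E.
Proof. by elim: E phi => [//|e E IH] phi /=; rewrite !IH. Qed.

Lemma edge_sum_insert phi e E F :
  (forall S S', S =i S' -> phi S = phi S') ->
  edge_sum phi (E ++ e :: F) = edge_sum phi (e :: E ++ F).
Proof.
elim: E phi => [//|a E IH] phi H; rewrite /= IH //= IH /=; last first.
  by move=> S S' SS'; apply: H => x; rewrite !inE SS'.
rewrite (@eq_edge_sum (fun S => phi [:: a, e & S]) (fun S => phi [:: e, a & S]));
  last by move=> S; apply: H => x; rewrite !inE orbCA.
by ring.
Qed.

Lemma perm_edge_sum phi E F : (forall S S', S =i S' -> phi S = phi S') ->
  perm_eq E F -> edge_sum phi E = edge_sum phi F.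
Proof.
elim: E phi F => [|e E IH] phi F H; first by rewrite perm_sym => /perm_nilP->.
move=> p; have : e \in F by rewrite -(perm_mem p) inE eqxx.
move=> /splitPr Fs; case: Fs p => F1 F2 p; rewrite edge_sum_insert //=.
have p' : perm_eq E (F1 ++ F2).
  by move: p; rewrite perm_sym -cat1s perm_catCA perm_cons perm_sym.
by rewrite !(IH _ _ _ p') // => S S' SS'; apply: H => x; rewrite !inE SS'.
Qed.

Definition edges_of E (A : {set 'I_(size E)}) : seq (T * T) :=
  [seq tnth (in_tuple E) i | i <- enum 'I_(size E) & i \in A].

Lemma mem_edges_of E (A : {set 'I_(size E)}) x :
  (x \in edges_of A) = [exists i in A, tnth (in_tuple E) i == x].
Proof.
apply/mapP/exists_inP => [[j] | [j jA /eqP <-]].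
  by rewrite mem_filter => /andP[jA _] ->; exists j.
by exists j => //; rewrite mem_filter jA mem_enum.
Qed.

Lemma size_edges_of E (A : {set 'I_(size E)}) : size (edges_of A) = #|A|.
Proof. by rewrite size_map cardE enumT; congr size; apply: eq_filter. Qed.

Definition cons_set n (p : bool * {set 'I_n}) : {set 'I_n.+1} :=
  [set i | if unlift ord0 i is Some j then j \in p.2 else p.1].

Lemma cons_set_bij n : bijective (@cons_set n).
Proof.
exists (fun A : {set 'I_n.+1} => (ord0 \in A, [set j | lift ord0 j \in A])).
  move=> [b A]; rewrite /cons_set inE unlift_none; congr (_, _).
  by apply/setP => j; rewrite !inE liftK.
move=> A; apply/setP => i; rewrite inE.
by case: unliftP => [j ->|->] //=; rewrite inE.
Qed.

Lemma edges_of_cons e E (p : bool * {set 'I_(size E)}) :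
  @edges_of (e :: E) (cons_set p) = if p.1 then e :: edges_of p.2 else edges_of p.2.
Proof.
case: p => b A; rewrite /edges_of enum_ordSl /= inE unlift_none /=.
have memL i : (lift ord0 i \in cons_set (b, A)) = (i \in A).
  by rewrite inE liftK.
have key (l : seq 'I_(size E)) :
    [seq tnth (in_tuple (e :: E)) i
      | i <- [seq i <- [seq lift ord0 i | i <- l] | i \in cons_set (b, A)]] =
    [seq tnth (in_tuple E) i | i <- l & i \in A].
  rewrite filter_map -map_comp.
  rewrite (@eq_filter _ _ (mem A) memL).
  by apply: eq_map => i /=; rewrite !(tnth_nth e).
by case: b memL key => memL key; [congr cons|]; exact: key.
Qed.

Lemma edge_sumE phi E : edge_sum phi E =
  \sum_(A : {set 'I_(size E)})
     (- 2%:R) ^+ #|A| * (1 + 'X) ^+ (size E - #|A|) * phi (edges_of A).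
Proof.
elim: E phi => [|e E IH] phi.
  rewrite (big_pred1 set0) => [|A] /=.
    rewrite cards0 !expr0 !mul1r; congr phi.
    by apply/esym/size0nil; rewrite size_edges_of cards0.
  by apply/esym/eqP/setP => -[].
(* Subsets are sorted by whether they contain the first edge. *)
rewrite [RHS](reindex (@cons_set (size E))) /=; last exact/onW_bij/cons_set_bij.
rewrite -(pair_bigA _ (fun b A => (- 2%:R) ^+ #|cons_set (b, A)| *
  (1 + 'X) ^+ ((size E).+1 - #|cons_set (b, A)|) *
  phi (@edges_of (e :: E) (cons_set (b, A))))) /=.
have card b (A : {set 'I_(size E)}) : #|cons_set (b, A)| = (b + #|A|)%N.
  rewrite -(@size_edges_of (e :: E) (cons_set (b, A))) -(size_edges_of A).
  rewrite (@edges_of_cons e E (b, A)).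
  by case: b.
have le (A : {set 'I_(size E)}) : (#|A| <= size E)%N.
  by rewrite -[X in (_ <= X)%N]card_ord max_card.
rewrite big_bool /= addrC !IH; congr (_ + _).
  rewrite mulr_sumr; apply: eq_bigr => A _.
  by rewrite card (edges_of_cons e (false, A)) /= add0n subSn // exprS; ring.
rewrite -mulNr mulr_sumr; apply: eq_bigr => A _.
by rewrite card (edges_of_cons e (true, A)) /= add1n subSS exprS; ring.
Qed.

End EdgeSums.

(** * J as a sum over connected spanning edge sets *)

Section JPolynomial.
Variables (R : realType) (T : finType).
Implicit Types (G : mgraph T) (V : {set T}) (E : seq (T * T)).

(* [(1 - X)^d * p ((-1 - X) / (1 - X))] *)
Definition mobius_hom d (p : {poly R}) : {poly R} :=
  \sum_(k < d.+1) p`_k *: ((-1 - 'X) ^+ k * (1 - 'X) ^+ (d - k)).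

Lemma mobius_hom_sum d (I : finType) (P : pred I) (F : I -> {poly R}) :
  mobius_hom d (\sum_(i | P i) F i) = \sum_(i | P i) mobius_hom d (F i).
Proof.
rewrite /mobius_hom exchange_big; apply: eq_bigr => k _ /=.
by rewrite coef_sum scaler_suml.
Qed.

Lemma mobius_homB d (p q : {poly R}) :
  mobius_hom d (p - q) = mobius_hom d p - mobius_hom d q.
Proof.
by rewrite /mobius_hom -sumrB; apply: eq_bigr => k _; rewrite coefB scalerBl.
Qed.

Lemma mobius_hom_mulX d (p : {poly R}) :
  mobius_hom d.+1 ('X * p) = (-1 - 'X) * mobius_hom d p.
Proof.
rewrite /mobius_hom big_ord_recl coefXM /= scale0r add0r mulr_sumr.
apply: eq_bigr => k _; rewrite coefXM /= subSS -scalerAr; congr (_ *: _).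
by rewrite exprS; ring.
Qed.

Lemma mobius_hom_lift d (p : {poly R}) : (size p <= d.+1)%N ->
  mobius_hom d.+1 p = (1 - 'X) * mobius_hom d p.
Proof.
move=> sz; rewrite /mobius_hom big_ord_recr /= (nth_default 0 sz) scale0r addr0.
rewrite mulr_sumr; apply: eq_bigr => k _; rewrite -scalerAr; congr (_ *: _).
by rewrite subSn ?exprS; [ring|exact: (ltn_ord k)].
Qed.

(** For q = (-1 - u) / (1 - u) one has 1 - q = 2 / (1 - u), so all powers of 1 - u cancel. *)
Lemma mobius_hom_term j l :
  (-1) ^+ (j + l) * mobius_hom (j + l) ((1 - 'X) ^+ j * 'X ^+ l) =
  (- 2%:R) ^+ j * (1 + 'X) ^+ l.
Proof.
elim: j => [|j IH].
  rewrite add0n !expr0 !mul1r; elim: l => [|l IH].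
    by rewrite /mobius_hom big_ord1 !expr0 !mulr1 mul1r coefC eqxx scale1r.
  by rewrite (exprS 'X) mobius_hom_mulX (exprS (-1)) (exprS (1 + 'X)) -IH; ring.
set p := (1 - 'X) ^+ j * 'X ^+ l in IH *.
have sz : (size p <= (j + l).+1)%N.
  apply: leq_trans (size_polyMleq _ _) _; rewrite size_polyXn addnS /=.
  rewrite -addSn leq_add2r; apply: leq_trans (size_poly_exp_leq _ _) _.
  rewrite ltnS -[leqRHS]mul1n leq_mul2r; apply/orP; right.
  rewrite -subn1 leq_subLR; apply: leq_trans (size_polyD _ _) _.
  by rewrite geq_max size_polyN size_polyX size_poly1.
rewrite (exprS (1 - 'X)) -mulrA -/p mulrBl mul1r addSn mobius_homB.
rewrite mobius_hom_mulX mobius_hom_lift // (exprS (- 2%:R)) -mulrA -IH.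
by rewrite (exprS (-1)); ring.
Qed.

Lemma spanning_connectedE G (S : {set 'I_(size (gE G))}) :
  spanning_connected S = conn (gV G) (edges_of S).
Proof.
have E : @sub_adj T G S =2 adj (edges_of S).
  move=> x y; rewrite /adj !mem_edges_of /sub_adj.
  apply/exists_inP/orP.
    case=> j jS /= /orP[] /andP[/eqP e1 /eqP e2]; [left|right];
      apply/exists_inP; exists j => //; rewrite (tnth_nth (x, x)) /=;
      by rewrite [X in X == _]surjective_pairing e1 e2.
  by case=> /exists_inP[j jS]; rewrite (tnth_nth (x, x)) /= => /eqP ej;
    exists j => //=; rewrite ej /= !eqxx ?orbT.
by apply: eq_forallb => x; congr (_ ==> _); apply: eq_forallb => y;
  congr (_ ==> _); apply: eq_connect.
Qed.

Definition conn_sum V E : {poly R} := edge_sum (fun S => (conn V S)%:R) E.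

Definition nhalf : {poly R} := ((- 2%:R)^-1)%:P.

Lemma nhalfE : 2%:R * nhalf = -1.
Proof.
by rewrite /nhalf -(polyC_natr R 2) -polyCM invrN mulrN divff ?pnatr_eq0 // polyCN.
Qed.

(** Connected spanning sets have at least n - 1 edges, so the division in H is exact term by term,
    and [mobius_hom_term] evaluates each term. *)
Lemma Jpoly_conn_sum G (k : nat) : #|gV G| = k.+1 ->
  Jpoly R G = nhalf ^+ k * conn_sum (gV G) (gE G).
Proof.
move=> cV; set m := size (gE G).
have kA (A : {set 'I_m}) : conn (gV G) (edges_of A) -> (k <= #|A| <= m)%N.
  move=> /conn_card; rewrite cV ltnS size_edges_of => ->.
  by rewrite -[X in (_ <= X)%N](card_ord m) max_card.
have one_neq : (1 - 'X : {poly R}) ^+ k != 0.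
  by rewrite expf_neq0 // -opprB oppr_eq0 -polyC1 polyXsubC_eq0.
have HE : Hpoly R G =
    \sum_(A : {set 'I_m} | conn (gV G) (edges_of A))
      (1 - 'X) ^+ (#|A| - k) * 'X ^+ (m - #|A|).
  rewrite /Hpoly /relpoly cV subn1 /= (eq_bigl _ _ (@spanning_connectedE G)).
  rewrite (_ : \sum_(_ | _) _ = (\sum_(A : {set 'I_m} | conn (gV G) (edges_of A))
      (1 - 'X) ^+ (#|A| - k) * 'X ^+ (m - #|A|)) * (1 - 'X) ^+ k).
    by rewrite mulpK.
  rewrite mulr_suml; apply: eq_bigr => A /kA/andP[kA' _].
  by rewrite -{1}(subnK kA') exprD; ring.
rewrite /Jpoly -/(mobius_hom _ _) HE mobius_hom_sum mulr_sumr.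
rewrite /conn_sum edge_sumE mulr_sumr big_mkcond; apply: eq_bigr => A _.
case: ifP => [cA|_]; last by rewrite !mulr0.
have /andP[h1 h2] := kA A cA; rewrite mulr1.
have -> : cyc_dim G = (#|A| - k + (m - #|A|))%N.
  by rewrite /cyc_dim cV -/m; lia.
have EA : (- 2%:R : {poly R}) ^+ #|A| = (- 2%:R) ^+ k * (- 2%:R) ^+ (#|A| - k).
  by rewrite -exprD subnKC.
rewrite mobius_hom_term EA -!mulrA.
by rewrite [RHS]mulrA -exprMn [nhalf * _]mulrC mulNr nhalfE opprK expr1n mul1r.
Qed.

End JPolynomial.
(** * Amicable pairs *)

Section Amicability.
Variables (R : realType) (T : finType).
Implicit Types (G N U : mgraph T) (V : {set T}) (E F S : seq (T * T)).
Implicit Types (v w : T).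

Local Notation nhalf := (nhalf R).
Local Notation conn_sum := (conn_sum R).

Lemma nhalf_exp k : nhalf ^+ k = - (2%:R * nhalf ^+ k.+1).
Proof. by rewrite exprS mulrA nhalfE mulN1r opprK. Qed.

Definition joined_sum V v w E : {poly R} :=
  edge_sum (fun S => (conn V ((v, w) :: S))%:R) E.

Lemma eq_conn_cons V e S S' : S =i S' -> conn V (e :: S) = conn V (e :: S').
Proof. by move=> SS'; apply: eq_conn => x; rewrite !inE SS'. Qed.

Lemma perm_conn_sum V E F : perm_eq E F -> conn_sum V E = conn_sum V F.
Proof. by apply: perm_edge_sum => S S' /(eq_conn V) ->. Qed.

Lemma perm_joined_sum V v w E F :
  perm_eq E F -> joined_sum V v w E = joined_sum V v w F.
Proof. by apply: perm_edge_sum => S S' /(eq_conn_cons V (v, w)) ->. Qed.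

Lemma conn_flip V v w S : conn V ((w, v) :: S) = conn V ((v, w) :: S).
Proof.
apply/idP/idP; apply: conn_generate => x y; rewrite inE => /orP[/eqP[-> ->]|xy].
- by rewrite connect_adj_sym; apply: connect_adj_edge; rewrite inE eqxx.
- by apply: connect_adj_edge; rewrite inE xy orbT.
- by rewrite connect_adj_sym; apply: connect_adj_edge; rewrite inE eqxx.
- by apply: connect_adj_edge; rewrite inE xy orbT.
Qed.

Definition parallel_to v w (e : T * T) := (e == (v, w)) || (e == (w, v)).

Lemma conn_sum_parallel V v w e E : parallel_to v w e ->
  conn_sum V (e :: E) = (1 + 'X) * conn_sum V E - 2%:R * joined_sum V v w E.
Proof.
move=> p; have c S : conn V (e :: S) = conn V ((v, w) :: S).
  by case/orP: p => /eqP->; [reflexivity|rewrite conn_flip].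
have -> : joined_sum V v w E = edge_sum (fun S => (conn V (e :: S))%:R) E.
  by apply: eq_edge_sum => S; rewrite c.
exact: edge_sum_cons.
Qed.

(** Once [v] and [w] are joined, [e] is redundant: keeping or deleting it gives the same sum, and
    the weights add up to (1 + u) - 2. *)
Lemma joined_sum_parallel V v w e E : parallel_to v w e ->
  joined_sum V v w (e :: E) = ('X - 1) * joined_sum V v w E.
Proof.
move=> p; have c S : conn V [:: (v, w), e & S] = conn V ((v, w) :: S).
  apply/idP/idP; last first.
    by apply: conn_sub => x; rewrite !inE => /orP[->|->]; rewrite ?orbT.
  apply: conn_generate => x y; rewrite !inE => /or3P[/eqP[-> ->]|/eqP E'|xy].
  - by apply: connect_adj_edge; rewrite inE eqxx.
  - case/orP: p; rewrite -E' => /eqP[-> ->]; last rewrite connect_adj_sym;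
      by apply: connect_adj_edge; rewrite inE eqxx.
  - by apply: connect_adj_edge; rewrite inE xy orbT.
have E' : edge_sum (fun S => (conn V [:: (v, w), e & S])%:R) E = joined_sum V v w E.
  by apply: eq_edge_sum => S; rewrite c.
by rewrite [LHS]edge_sum_cons E' -/(joined_sum V v w E); ring.
Qed.

(* When no edge of [E] joins [v] and [w], [delta] is J^-, [joined] is the J of
   the identification and [alpha] is their sum, for [k + 2] vertices. *)
Definition delta k V E : {poly R} := nhalf ^+ k.+1 * conn_sum V E.
Definition joined k V v w E : {poly R} := nhalf ^+ k * joined_sum V v w E.
Definition alpha k V v w E : {poly R} := delta k V E + joined k V v w E.

(** Amicability concerns only the graph without the edges between [v] and [w]. They are restored one
    at a time, each sending (alpha, delta) to (u alpha + delta, u delta + alpha). *)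
Lemma parity_square_parallel k V v w E :
  let F := [seq e <- E | ~~ parallel_to v w e] in
  parity_square (alpha k V v w F) (delta k V F) ->
  parity_square (alpha k V v w E) (delta k V E).
Proof.
move=> F; have pE : perm_eq E ([seq e <- E | parallel_to v w e] ++ F).
  by rewrite perm_sym perm_filterC.
rewrite /alpha /delta /joined (perm_conn_sum V pE) (perm_joined_sum V v w pE).
rewrite -/(delta _ _ _) -/(joined _ _ _ _ _) -/(alpha _ _ _ _ _).
have : all (parallel_to v w) [seq e <- E | parallel_to v w e] by apply: filter_all.
elim: [seq e <- E | _] => [//|e K IH] /= /andP[pe pK] sq.
have h := nhalf_exp k.
have := parity_square_add_edge (IH pK sq); congr parity_square.
  rewrite /alpha /delta /joined (conn_sum_parallel V _ pe) (joined_sum_parallel V _ pe).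
  by rewrite h; ring.
rewrite /alpha /delta /joined (conn_sum_parallel V _ pe).
by rewrite h; ring.
Qed.

Lemma edges_in_sub V E F : edges_in V E -> {subset F <= E} -> edges_in V F.
Proof. by move=> EV sub e /sub/EV. Qed.

Lemma edges_in_cons V e E : e.1 \in V -> e.2 \in V -> edges_in V E ->
  edges_in V (e :: E).
Proof. by move=> e1 e2 EV f; rewrite inE => /orP[/eqP->|/EV]. Qed.

Lemma edge_sum_prod_conn V1 V2 v E F (pre : seq (T * T)) : V1 :&: V2 = [set v] ->
  edges_in V1 E -> edges_in V2 F -> edges_in V1 pre ->
  edge_sum (fun S => (conn (V1 :|: V2) (pre ++ S))%:R) (E ++ F) =
  edge_sum (fun S => (conn V1 (pre ++ S))%:R) E * conn_sum V2 F :> {poly R}.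
Proof.
move=> V12 E1 F2 pre1; apply: edge_sum_prod => S1 S2 s1 s2.
have pS1 : edges_in V1 (pre ++ S1).
  by move=> e; rewrite mem_cat => /orP[/pre1|/s1/E1].
by rewrite catA (conn_union_vertex V12 pS1 (edges_in_sub F2 s2)) -natrM mulnb.
Qed.

Lemma conn_sum_union V1 V2 v E F : V1 :&: V2 = [set v] ->
  edges_in V1 E -> edges_in V2 F ->
  conn_sum (V1 :|: V2) (E ++ F) = conn_sum V1 E * conn_sum V2 F.
Proof. by move=> V12 E1 F2; apply: (edge_sum_prod_conn (pre := [::]) V12). Qed.

Lemma joined_sum_union V1 V2 v w E F : V1 :&: V2 = [set v] -> w \in V1 ->
  edges_in V1 E -> edges_in V2 F ->
  joined_sum (V1 :|: V2) v w (E ++ F) = joined_sum V1 v w E * conn_sum V2 F.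
Proof.
move=> V12 w1 E1 F2; apply: (edge_sum_prod_conn (pre := [:: (v, w)]) V12) => //.
by apply: edges_in_cons => //=; case: (common_vertex V12).
Qed.

Section Parallel.
Variables (V1 V2 : {set T}) (v w1 w2 : T) (E F : seq (T * T)).
Hypotheses (V12 : V1 :&: V2 = [set v]) (E1 : edges_in V1 E) (F2 : edges_in V2 F).
Hypotheses (w1V : w1 \in V1) (w1v : w1 != v) (w2V : w2 \in V2) (w2v : w2 != v).

(** Inclusion and exclusion for the disjunction in [conn_parallel]: both alternatives hold exactly
    when each side is connected by itself. *)
Lemma joined_sum_parallel_connection :
  joined_sum (V1 :|: V2) w1 w2 (E ++ F) =
  conn_sum V1 E * joined_sum V2 v w2 F + joined_sum V1 v w1 E * conn_sum V2 F
  - conn_sum V1 E * conn_sum V2 F.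
Proof.
rewrite /joined_sum [LHS]edge_sum_cat.
pose c1 S : {poly R} := (conn V1 S)%:R; pose c2 S : {poly R} := (conn V2 S)%:R.
pose d1 S : {poly R} := (conn V1 ((v, w1) :: S))%:R.
pose d2 S : {poly R} := (conn V2 ((v, w2) :: S))%:R.
rewrite -[conn_sum V1 E]/(edge_sum c1 E) -[conn_sum V2 F]/(edge_sum c2 F).
rewrite -/(edge_sum d1 E) -/(edge_sum d2 F).
transitivity (edge_sum (fun S1 =>
    (edge_sum d2 F - edge_sum c2 F) * c1 S1 + edge_sum c2 F * d1 S1) E); last first.
  by rewrite edge_sumD !edge_sumMl; ring.
apply: edge_sum_ext => S1 s1.
transitivity (edge_sum (fun S2 => c1 S1 * d2 S2 + (d1 S1 - c1 S1) * c2 S2) F);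
  last by rewrite edge_sumD !edge_sumMl; ring.
apply: edge_sum_ext => S2 s2.
rewrite (conn_parallel V12 (edges_in_sub E1 s1) (edges_in_sub F2 s2)) //.
rewrite /c1 /c2 /d1 /d2.
have le1 : conn V1 S1 -> conn V1 ((v, w1) :: S1).
  by apply: conn_sub => x; rewrite inE orbC => ->.
have le2 : conn V2 S2 -> conn V2 ((v, w2) :: S2).
  by apply: conn_sub => x; rewrite inE orbC => ->.
case: (conn V1 S1) le1 => [/(_ isT)->|_]; case: (conn V2 S2) le2 => [/(_ isT)->|_];
  case: (conn V1 ((v, w1) :: S1)); case: (conn V2 ((v, w2) :: S2)) => /=; ring.
Qed.

Lemma edge_sum_parallel_joined :
  edge_sum (fun S => (conn (V1 :|: V2) [:: (w1, w2), (v, w1) & S])%:R) (E ++ F) =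
  joined_sum V1 v w1 E * joined_sum V2 v w2 F.
Proof.
apply: edge_sum_prod => S1 S2 s1 s2.
rewrite (conn_parallel_joined V12 (edges_in_sub E1 s1) (edges_in_sub F2 s2)) //.
by rewrite -natrM mulnb.
Qed.

End Parallel.

End Amicability.

(** * Amicability in terms of alpha and delta *)

Section Networks.
Variables (R : realType) (T : finType).
Implicit Types (G N U : mgraph T) (V : {set T}) (E F S : seq (T * T)).
Implicit Types (v w : T).

Local Notation nhalf := (nhalf R).
Local Notation conn_sum := (conn_sum R).
Local Notation joined_sum := (joined_sum R).
Local Notation delta := (delta R).
Local Notation joined := (joined R).
Local Notation alpha := (alpha R).

Lemma amicableE G v w : amicable R G v w <->
  parity_square (Jpoly R (del_edges G v w) + Jpoly R (identify G v w))
                (Jpoly R (del_edges G v w)).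
Proof. by rewrite /parity_square odd_polyD even_polyD. Qed.

Lemma loopless_edges_in G : loopless_mg G -> edges_in (gV G) (gE G).
Proof. by move=> H e /H[]. Qed.

(** In a loopless graph the loops created by the identification come exactly from the edges between
    [v] and [w]. *)
Lemma identify_edges G v w : loopless_mg G ->
  gE (identify G v w) = relabel_edges v w (gE (del_edges G v w)).
Proof.
move=> H; rewrite /= filter_map /relabel_edges; congr map.
apply: eq_in_filter => -[a b] /H[/= _ _ ab]; rewrite /= !xpair_eqE.
have [aw|aw] := eqVneq a w; have [bw|bw] := eqVneq b w.
- by rewrite aw bw eqxx in ab.
- by rewrite andbF /= eq_sym.
- by rewrite andbT orbF.
- by rewrite andbF ab.
Qed.

Lemma conn_sum_identify V v w E : v \in V -> v != w ->
  conn_sum (V :\ w) (relabel_edges v w E) = joined_sum V v w E.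
Proof.
move=> vV vw; rewrite /conn_sum /relabel_edges edge_sum_map.
by apply: eq_edge_sum => S; rewrite -(conn_identify S vV vw).
Qed.

Lemma card_identify V w k : w \in V -> #|V| = k.+1 -> #|V :\ w| = k.
Proof. by move=> wV; rewrite (cardsD1 w V) wV => -[]. Qed.

Lemma Jpoly_del_edges G v w k : #|gV G| = k.+2 ->
  Jpoly R (del_edges G v w) = delta k (gV G) (gE (del_edges G v w)).
Proof. by move=> cV; rewrite (@Jpoly_conn_sum R T (del_edges G v w) k.+1). Qed.

Lemma Jpoly_identify G v w k : loopless_mg G -> v \in gV G -> w \in gV G ->
  v != w -> #|gV G| = k.+2 ->
  Jpoly R (identify G v w) = joined k (gV G) v w (gE (del_edges G v w)).
Proof.
move=> Gl vV wV vw cV; rewrite (@Jpoly_conn_sum R T _ k) ?identify_edges //=.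
  by rewrite conn_sum_identify.
exact: card_identify.
Qed.

Lemma amicable_alpha_delta G v w k : loopless_mg G -> v \in gV G -> w \in gV G ->
  v != w -> #|gV G| = k.+2 ->
  amicable R G v w <->
  parity_square (alpha k (gV G) v w (gE (del_edges G v w)))
                (delta k (gV G) (gE (del_edges G v w))).
Proof.
move=> Gl vV wV vw cV.
by rewrite amicableE (Jpoly_del_edges _ _ cV) (Jpoly_identify _ _ _ _ cV).
Qed.

Lemma amicable_parity_square G v w k : loopless_mg G -> v \in gV G -> w \in gV G ->
  v != w -> #|gV G| = k.+2 -> amicable R G v w ->
  parity_square (alpha k (gV G) v w (gE G)) (delta k (gV G) (gE G)).
Proof.
move=> Gl vV wV vw cV /(amicable_alpha_delta Gl vV wV vw cV).
exact: parity_square_parallel.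
Qed.

(** For the full edge list [delta] is J of the network itself, the factor that a one-vertex union
    contributes. *)
Lemma amicable_hurwitz G v w k : loopless_mg G -> v \in gV G -> w \in gV G ->
  v != w -> #|gV G| = k.+2 -> amicable R G v w ->
  hurwitz (delta k (gV G) (gE G)).
Proof.
move=> Gl vV wV vw cV /(amicable_parity_square Gl vV wV vw cV).
by move=> /parity_square_elim[].
Qed.

Lemma two_vertices V v w : v \in V -> w \in V -> v != w -> exists k, #|V| = k.+2.
Proof.
move=> vV wV vw; exists (#|V :\ v :\ w|).
by rewrite (cardsD1 v) vV (cardsD1 w (V :\ v)) !inE eq_sym vw wV.
Qed.

Lemma cards_union_vertex V1 V2 v k1 k2 : V1 :&: V2 = [set v] ->
  #|V1| = k1.+2 -> #|V2| = k2.+2 -> #|V1 :|: V2| = (k1 + k2).+3.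
Proof. by move=> V12 c1 c2; rewrite cardsU V12 cards1 c1 c2; lia. Qed.

Lemma edges_del_disjoint V E v w : edges_in V E -> w \notin V ->
  [seq e <- E | ~~ parallel_to v w e] = E.
Proof.
move=> EV wV; apply/all_filterP/allP => -[a b] /EV[/= aV bV].
rewrite /parallel_to !xpair_eqE; apply/norP; split; apply/nandP.
  by right; apply: contraNneq wV => <-.
by left; apply: contraNneq wV => <-.
Qed.

Lemma del_edges_in V E (p : pred (T * T)) : edges_in V E -> edges_in V [seq e <- E | p e].
Proof. by move=> EV e; rewrite mem_filter => /andP[_ /EV]. Qed.

(* Up to a permutation of the edges, since [union_mg] lists those of its first
   argument first and the lemma is needed for both sides. *)
Lemma amicable_union G N U v w k1 k2 :
  loopless_mg G -> loopless_mg N -> loopless_mg U ->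
  gV G :&: gV N = [set v] -> w \in gV G -> w != v ->
  #|gV G| = k1.+2 -> #|gV N| = k2.+2 ->
  gV U = gV G :|: gV N -> perm_eq (gE U) (gE G ++ gE N) ->
  hurwitz (delta k2 (gV N) (gE N)) -> amicable R G v w -> amicable R U v w.
Proof.
move=> Gl Nl Ul V12 wG wv c1 c2 VU pU hN.
have [v1 v2] := common_vertex V12.
have vw : v != w by rewrite eq_sym.
have wN : w \notin gV N.
  by apply: contra wv => wN; apply/eqP; apply: (common_vertex_only V12).
have cU : #|gV U| = (k1 + k2).+1.+2 by rewrite VU (cards_union_vertex V12 c1 c2).
have [vU wU] : v \in gV U /\ w \in gV U by rewrite VU !inE v1 wG.
move=> /(amicable_alpha_delta Gl v1 wG vw c1) sq.
apply/(amicable_alpha_delta Ul vU wU vw cU).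
have [EG EN] := (loopless_edges_in Gl, loopless_edges_in Nl).
set F := gE (del_edges G v w) in sq.
have FG : edges_in (gV G) F by apply: del_edges_in.
have pE : perm_eq (gE (del_edges U v w)) (F ++ gE N).
  apply: (perm_trans (perm_filter _ pU)); rewrite filter_cat.
  by rewrite [X in _ ++ X](edges_del_disjoint _ EN wN).
rewrite /alpha /delta /joined (perm_conn_sum _ _ pE) (perm_joined_sum _ _ _ _ pE) VU.
rewrite (conn_sum_union _ V12 FG EN) (joined_sum_union _ V12 wG FG EN).
have := parity_square_mul hN sq; rewrite /alpha /delta /joined.
have -> : nhalf ^+ (k1 + k2).+2 = nhalf ^+ k1.+1 * nhalf ^+ k2.+1.
  by rewrite -exprD addSn addnS.
have -> : nhalf ^+ (k1 + k2).+1 = nhalf ^+ k1 * nhalf ^+ k2.+1.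
  by rewrite -exprD addnS.
by congr parity_square; ring.
Qed.

Lemma loopless_union G N : loopless_mg G -> loopless_mg N ->
  loopless_mg (union_mg G N).
Proof.
move=> Gl Nl e; rewrite mem_cat => /orP[/Gl|/Nl] [e1 e2 e12];
  by split; rewrite // inE ?e1 ?e2 ?orbT.
Qed.

Lemma loopless_identify G v w : loopless_mg G -> v \in gV G -> v != w ->
  loopless_mg (identify G v w).
Proof.
move=> Gl vV vw e; rewrite mem_filter => /andP[e12 /mapP[[a b] /Gl[/= aV bV _] ee]].
have r x : x \in gV G -> (if x == w then v else x) \in gV G :\ w.
  by have [_|xw] := eqVneq x w => xV; rewrite !inE ?vw ?xw.
by split=> //; rewrite ee; exact: r.
Qed.

(** * Two networks glued at two vertices *)

Section Gluing.
Variables (G N : mgraph T) (v w1 w2 : T) (k1 k2 : nat).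
Hypotheses (Gl : loopless_mg G) (Nl : loopless_mg N).
Hypothesis V12 : gV G :&: gV N = [set v].
Hypotheses (w1V : w1 \in gV G) (w1v : w1 != v) (w2V : w2 \in gV N) (w2v : w2 != v).
Hypotheses (c1 : #|gV G| = k1.+2) (c2 : #|gV N| = k2.+2).

Let U := union_mg G N.
Let W := identify U w1 w2.

Let EG : edges_in (gV G) (gE G). Proof. exact: loopless_edges_in. Qed.
Let EN : edges_in (gV N) (gE N). Proof. exact: loopless_edges_in. Qed.

Let w1N : w1 \notin gV N.
Proof. by apply: contra w1v => ?; apply/eqP; apply: (common_vertex_only V12). Qed.

Let w2G : w2 \notin gV G.
Proof. by apply: contra w2v => ?; apply/eqP; apply: (common_vertex_only V12). Qed.

Let w12 : w1 != w2.
Proof. by apply: contraNneq w1N => ->. Qed.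

Let Ul : loopless_mg U. Proof. exact: loopless_union. Qed.

Let w1U : w1 \in gV U. Proof. by rewrite inE w1V. Qed.
Let w2U : w2 \in gV U. Proof. by rewrite inE w2V orbT. Qed.
Let cU : #|gV U| = (k1 + k2).+3. Proof. exact: (cards_union_vertex V12). Qed.

Lemma del_edges_union : gE (del_edges U w1 w2) = gE G ++ gE N.
Proof.
rewrite /= filter_cat (edges_del_disjoint w1 EG w2G).
rewrite (eq_filter (a2 := fun e => ~~ parallel_to w2 w1 e)).
  by rewrite (edges_del_disjoint w2 EN w1N).
by move=> e; rewrite /parallel_to orbC.
Qed.

Lemma edges_glued : gE W = relabel_edges w1 w2 (gE G ++ gE N).
Proof. by rewrite identify_edges // del_edges_union. Qed.

(** The edges between [v] and the glued vertex come from those between [v] and [w1] in [G] and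
    between [v] and [w2] in [N]. *)
Lemma del_edges_glued : gE (del_edges W v w1) =
  relabel_edges w1 w2 (gE (del_edges G v w1) ++ gE (del_edges N v w2)).
Proof.
have -> : gE (del_edges W v w1) = [seq e <- gE W | ~~ parallel_to v w1 e] by [].
rewrite edges_glued /relabel_edges filter_map; congr map.
rewrite filter_cat; congr (_ ++ _); apply: eq_in_filter => -[a b].
  move=> /EG[/= aG bG]; rewrite /= /relabel.
  have -> : a == w2 = false by apply: contraNF w2G => /eqP <-.
  by have -> : b == w2 = false by apply: contraNF w2G => /eqP <-.
move=> /EN[/= aN bN]; rewrite /parallel_to /= /relabel !xpair_eqE.
have rv x : ((if x == w2 then w1 else x) == v) = (x == v).
  by have [->|//] := eqVneq x w2; rewrite (negPf w1v) (negPf w2v).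
have r x : x \in gV N -> ((if x == w2 then w1 else x) == w1) = (x == w2).
  by case: (x == w2); rewrite ?eqxx // => xN; apply: contraNF w1N => /eqP <-.
by rewrite !rv !r.
Qed.

(** The correction term of the inclusion and exclusion becomes 2 delta delta' after normalization by
    powers of -1/2; it supplies the delta delta' contained in each of the two products. *)
Lemma Jpoly_glued : Jpoly R W =
  delta k1 (gV G) (gE G) * alpha k2 (gV N) v w2 (gE N) +
  alpha k1 (gV G) v w1 (gE G) * delta k2 (gV N) (gE N).
Proof.
rewrite (Jpoly_identify Ul w1U w2U w12 cU) del_edges_union /joined.
rewrite (joined_sum_parallel_connection _ V12 EG EN) //.
rewrite /alpha /delta /joined -addSn exprD (nhalf_exp R k1) (nhalf_exp R k2).
by rewrite !exprS; ring.
Qed.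

(** For the glued network, delta is delta alpha' + alpha delta' and joined is the product of the two
    joined polynomials, so alpha is alpha alpha' + delta delta'. *)
Lemma amicable_glued : amicable R G v w1 -> amicable R N v w2 -> amicable R W v w1.
Proof.
have [v1 v2] := common_vertex V12.
have vw1 : v != w1 by rewrite eq_sym.
have vw2 : v != w2 by rewrite eq_sym.
have Wl : loopless_mg W by apply: loopless_identify.
have vW : v \in gV W by rewrite !inE vw2 v1.
have w1W : w1 \in gV W by rewrite !inE w12 w1V.
have cW : #|gV W| = (k1 + k2).+2 by apply: card_identify.
move=> /(amicable_alpha_delta Gl v1 w1V vw1 c1) sqG.
move=> /(amicable_alpha_delta Nl v2 w2V vw2 c2) sqN.
apply/(amicable_alpha_delta Wl vW w1W vw1 cW); rewrite del_edges_glued.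
set E := gE (del_edges G v w1) in sqG *; set F := gE (del_edges N v w2) in sqN *.
have E1 : edges_in (gV G) E by apply: del_edges_in.
have F2 : edges_in (gV N) F by apply: del_edges_in.
have dE : conn_sum (gV W) (relabel_edges w1 w2 (E ++ F)) =
    conn_sum (gV G) E * joined_sum (gV N) v w2 F +
    joined_sum (gV G) v w1 E * conn_sum (gV N) F -
    conn_sum (gV G) E * conn_sum (gV N) F.
  by rewrite conn_sum_identify // (joined_sum_parallel_connection _ V12 E1 F2).
have jE : joined_sum (gV W) v w1 (relabel_edges w1 w2 (E ++ F)) =
    joined_sum (gV G) v w1 E * joined_sum (gV N) v w2 F.
  rewrite -(edge_sum_parallel_joined _ V12 E1 F2) //.
  rewrite /joined_sum /relabel_edges edge_sum_map; apply: eq_edge_sum => S.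
  have -> : (v, w1) :: relabel_edges w1 w2 S = relabel_edges w1 w2 ((v, w1) :: S).
    by rewrite /= /relabel (negPf vw2) (negPf w12).
  by rewrite (conn_identify ((v, w1) :: S) w1U w12).
have := parity_square_par sqG sqN.
rewrite /alpha /delta /joined dE jE (nhalf_exp R k1) (nhalf_exp R k2).
rewrite (nhalf_exp R (k1 + k2)).
have -> : nhalf ^+ (k1 + k2).+1 = - (2%:R * (nhalf ^+ k1.+1 * nhalf ^+ k2.+1)).
  by rewrite -exprD addSn addnS -nhalf_exp.
by congr parity_square; ring.
Qed.

Lemma very_amicable_union : amicable R G v w1 -> amicable R N v w2 ->
  very_amicable R U w1 w2.
Proof.
have [v1 v2] := common_vertex V12.
have vw1 : v != w1 by rewrite eq_sym.
have vw2 : v != w2 by rewrite eq_sym.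
(* Deleting the edges between [w1] and [w2] leaves those at [v] in place, so the squares for the
   full edge lists are needed. *)
move=> /(amicable_parity_square Gl v1 w1V vw1 c1) sqG.
move=> /(amicable_parity_square Nl v2 w2V vw2 c2) sqN.
change (parity_square (Jpoly R W) (Jpoly R (del_edges U w1 w2))).
rewrite Jpoly_glued (Jpoly_del_edges _ _ cU) del_edges_union /delta.
rewrite (conn_sum_union _ V12 EG EN).
have := parity_square_ser sqG sqN; congr parity_square.
by rewrite /delta -addSn -addnS exprD; ring.
Qed.

End Gluing.
End Networks.

(** * Unions and gluings of networks with amicable pairs *)

Theorem theorem5p2 (R : realType) (T : finType) (G N : mgraph T)
    (v w' w'' : T) :
  network G -> network N ->
  gV G :&: gV N = [set v] ->
  w' \in gV G -> w' != v ->
  w'' \in gV N -> w'' != v ->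
  amicable R G v w' -> amicable R N v w'' ->
  let U := union_mg G N in
  let W := identify U w' w'' in
  [/\ amicable R U v w' /\ amicable R U v w'',
      amicable R W v w'
    & very_amicable R U w' w''].
Proof.
move=> [Gl _ _] [Nl _ _] V12 w1V w1v w2V w2v aG aN U W.
have [v1 v2] := common_vertex V12.
have [vw1 vw2] : v != w' /\ v != w'' by rewrite !(eq_sym v).
have [k1 c1] := two_vertices v1 w1V vw1.
have [k2 c2] := two_vertices v2 w2V vw2.
have Ul : loopless_mg U by apply: loopless_union.
split; [split| |].
- apply: (amicable_union Gl Nl Ul V12 w1V w1v c1 c2) => //.
  exact: amicable_hurwitz aN.
- apply: (amicable_union Nl Gl Ul _ w2V w2v c2 c1) => //.
  + by rewrite setIC.
  + by rewrite setUC.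
  + by rewrite perm_catC.
  exact: amicable_hurwitz aG.
- exact: (amicable_glued Gl Nl V12 w1V w1v w2V w2v c1 c2).
- exact: (very_amicable_union Gl Nl V12 w1V w1v w2V w2v c1 c2).
Qed.
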